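(* For every $k\ge1$ and every partition $\mu$, the completion coefficients $\rho_{k,\mu}$ are given by $$\rho_{k,\mu}=(k-1)!\,\frac{\prod_i\mu_i}{d!}\,[z^{2g}]\;\mathcal{S}(z)^{d-1}\prod_i\mathcal{S}(\mu_iz),$$ where $[z^{2g}]$ stands for the coefficient of $z^{2g}$ and the numbers $d$ and $g$ are defined by $$d=|\mu|,\qquad k+1=|\mu|+\ell(\mu)+2g.$$
   Context: $\mathcal{S}(z)=\dfrac{\sinh(z/2)}{z/2}$, an even power series in $z$; the coefficient of $z^{j}$ is zero for $j$ odd or negative. For a partition $\mu$, $|\mu|$ is the size and $\ell(\mu)$ the number of parts. Completion coefficients. $\mathcal{Z}(d)$ is the center of $\mathbb{Q}S(d)$ and $(\mu)=C_\mu\in\mathcal{Z}(|\mu|)$ is the conjugacy class (sum) of cycle type $\mu$. For partitions $\mu,\lambda$ put $\mathbf{f}_\mu(\lambda)=\binom{|\lambda|}{|\mu|}|C_\mu|\frac{\chi^\lambda_\mu}{\dim\lambda}$, $\mathbf{f}_\emptyset=1$, where $|C_\mu|$ is the size of the class in $S(|\mu|)$ and $\chi^\lambda_\mu$ is the value of the irreducible character $\chi^\lambda$ of $S(|\lambda|)$ on an element of cycle type $\mu$ (via $S(|\mu|)\subset S(|\lambda|)$); $\mathbf{f}_\mu(\lambda)=0$ for $|\mu|>|\lambda|$. Let $$\mathbf{p}_k(\lambda)=\sum_{i=1}^\infty\Big[(\lambda_i-i+\tfrac12)^k-(-i+\tfrac12)^k\Big]+(1-2^{-k})\zeta(-k),\qquad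 k\ge1,$$ and $\Lambda^*=\mathbb{Q}[\mathbf{p}_1,\mathbf{p}_2,\dots]$, regarded as functions on the set of partitions. It is known (Kerov-Olshanski) that $\phi:\bigoplus_{d\ge0}\mathcal{Z}(d)\to\Lambda^*$, $C_\mu\mapsto\mathbf{f}_\mu$, is a linear isomorphism. The completed cycle is $\overline{(k)}=\frac1k\phi^{-1}(\mathbf{p}_k)$, and the completion coefficients $\rho_{k,\mu}$ are defined by $\overline{(k)}=\sum_\mu\rho_{k,\mu}\cdot(\mu)$, the sum over all partitions (including $\emptyset$). *)

(* Defs.v *)
From HB Require Import structures.
From mathcomp Require Import all_boot all_order all_fingroup all_algebra.
From mathcomp Require Import all_solvable all_field all_character finmap.
From Stdlib Require Import ClassicalEpsilon.

Set Implicit Arguments.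
Unset Strict Implicit.
Unset Printing Implicit Defensive.

Import Order.TTheory GRing.Theory Num.Theory.

Local Open Scope ring_scope.

Definition is_intpart (s : seq nat) := sorted geq s && (0 \notin s)%N.

Record intpart := IntPart { parts :> seq nat; partsP : is_intpart parts }.
HB.instance Definition _ := [isSub for parts].
HB.instance Definition _ := [Choice of intpart by <:].

(* |mu|; the length l(mu) is [size mu] *)
Definition psize (mu : intpart) : nat := sumn mu.

Definition conj_parts (s : seq nat) : seq nat :=
  [seq count (fun p => (j < p)%N) s | j <- iota 0 (head 0%N s)].

Definition cycle_lengths d (w : 'S_d) : seq nat :=
  sort geq [seq #|B| | B : {set 'I_d} <- enum (porbits w)].

Fact cycle_lengths_intpart d (w : 'S_d) : is_intpart (cycle_lengths w).
Proof.
apply/andP; split.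
  by apply: sort_sorted => m n; rewrite /geq /= leq_total.
rewrite mem_sort; apply/mapP => -[B]; rewrite mem_enum => /imsetP[x _ ->].
by move/esym/eqP; rewrite cards_eq0 => /set0Pn[]; exists x; apply: porbit_id.
Qed.

Definition cycle_type d (w : 'S_d) : intpart := IntPart (cycle_lengths_intpart w).

(* The group algebra Q S(d): functions 'S_d -> Q under convolution. *)
Definition grpalg d := {ffun 'S_d -> rat}.

Definition grpalg_mul d (x y : grpalg d) : grpalg d :=
  [ffun w => \sum_(u : 'S_d) x u * y (u^-1 * w)%g].

Definition in_center d (x : grpalg d) : Prop :=
  forall y : grpalg d, grpalg_mul x y = grpalg_mul y x.

(* Elements of the product of all Q S(d), and the predicate carving out the  *)
(* direct sum of the centers Z(d).                                           *)
Definition grpalgs := forall d, grpalg d.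

Definition in_sum_centers (x : grpalgs) : Prop :=
  (forall d, in_center (x d)) /\
  (exists N : nat, forall d, (N <= d)%N -> x d = 0).

(* The class sum (mu) = C_mu, placed in degree |mu|: a permutation of cycle  *)
(* type mu lies in S(|mu|), so the other components vanish.                  *)
Definition class_sum (mu : intpart) : grpalgs :=
  fun d => [ffun w : 'S_d => (cycle_type w == mu)%:R].

Definition class_size (mu : intpart) : nat :=
  #|[set w : 'S_(psize mu) | cycle_type w == mu]|.

(* The Young subgroup of S(n) preserving consecutive blocks of sizes         *)
(* s_0, s_1, ...; [reshape_index s i] is the index of the block of i.        *)
Definition young_set n (s : seq nat) : {set 'S_n} :=
  [set w : 'S_n | [forall i : 'I_n, reshape_index s (w i) == reshape_index s i]].

Fact young_group_set n s : group_set (young_set n s).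
Proof.
apply/group_setP; split=> [|u v].
  by rewrite inE; apply/forallP => i; rewrite perm1.
rewrite !inE => /forallP hu /forallP hv; apply/forallP => i.
by rewrite permM (eqP (hv _)).
Qed.

Canonical young_group n s := group (young_group_set n s).

Fact sign_cfun_subproof n :
  is_class_fun <<[set: 'S_n]>>%g [ffun w : 'S_n => (-1) ^+ odd_perm w : algC].
Proof.
apply: intro_class_fun => [u v _ _ | u]; first by rewrite odd_permJ.
by rewrite mem_gen ?inE.
Qed.

Definition sign_cfun n : 'CF([set: 'S_n]) := Cfun 0 (sign_cfun_subproof n).

(* chi^lambda is the common irreducible constituent of the inductions of the *)
(* trivial character of the Young subgroup of type lambda and of the sign    *)
(* character of the Young subgroup of type lambda'. This is the standard     *)
(* labelling: chi^(n) is the trivial character. The constituent is unique.   *)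
Definition chi_index (la : intpart) : Iirr [set: 'S_(psize la)] :=
  odflt 0 [pick i |
    (i \in irr_constt ('Ind[[set: 'S_(psize la)]]
        (1 : 'CF(young_group (psize la) la)))) &&
    (i \in irr_constt ('Ind[[set: 'S_(psize la)]]
        ('Res[young_group (psize la) (conj_parts la)]
           (sign_cfun (psize la)))))].

Definition chi (la : intpart) : 'CF([set: 'S_(psize la)]) := 'chi_(chi_index la).

Definition dim_chi (la : intpart) : algC := chi la 1%g.

(* chi^lambda_mu for |mu| <= |lambda|: seen in S(|lambda|), a permutation of *)
(* cycle type mu acquires |lambda| - |mu| fixed points.                      *)
Definition chi_at (la mu : intpart) : algC :=
  if [pick w : 'S_(psize la) | parts (cycle_type w)
        == parts mu ++ nseq (psize la - psize mu) 1%N] is Some w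
  then chi la w else 0.

Definition f_ (mu la : intpart) : algC :=
  if (psize mu <= psize la)%N then
    'C(psize la, psize mu)%:R * (class_size mu)%:R * chi_at la mu / dim_chi la
  else 0.

(* The linear map with phi C_mu = f_mu, with values in functions on          *)
(* partitions: a central x is the sum over w of x(w) / |C_mu| times C_mu,    *)
(* mu the cycle type of w. Degrees d > |lambda| do not contribute since      *)
(* f_mu(lambda) = 0 for |mu| > |lambda|.                                     *)
Definition phi (x : grpalgs) (la : intpart) : algC :=
  \sum_(d < (psize la).+1) \sum_(w : 'S_d)
     ratr (x d w) * (f_ (cycle_type w) la / (class_size (cycle_type w))%:R).

Fact psize_cycle_type d (w : 'S_d) : psize (cycle_type w) = d.
Proof.
rewrite /psize /= /cycle_lengths.
rewrite (perm_sumn (permEl (perm_sort _ _))) sumnE big_map big_enum /=.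
have acts_w : [acts <[w]>%g, on [set: 'I_d] | 'P].
  by apply/actsP => u _ i; rewrite !inE.
have porbits_orb : porbits w = orbit 'P <[w]>%G @: [set: 'I_d].
  by apply/setP => B; apply/imsetP/imsetP => -[x _ ->]; exists x; rewrite ?inE ?porbit.unlock.
by rewrite porbits_orb -(card_partition (orbit_partition acts_w)) cardsT card_ord.
Qed.

Fact phi_class_sum (mu : intpart) : phi (class_sum mu) =1 f_ mu.
Proof.
move=> la; rewrite /phi.
case: (leqP (psize mu) (psize la)) => [le_mu|lt_la]; last first.
  rewrite /f_ leqNgt lt_la big1 // => d _; rewrite big1 // => w _.
  rewrite ffunE; case: eqP => [mu_w|_]; last by rewrite rmorph0 mul0r.
  have def_d : psize mu = d by rewrite -mu_w psize_cycle_type.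
  by have := ltn_ord d; rewrite ltnS leqNgt -{1}def_d lt_la.
rewrite (bigD1 (Ordinal (le_mu : (psize mu < (psize la).+1)%N))) //=.
rewrite [X in _ + X]big1 => [|d ne_d]; last first.
  rewrite big1 // => w _; rewrite ffunE; case: eqP => [mu_w|_].
    by case/eqP: ne_d; apply: val_inj; rewrite /= -mu_w psize_cycle_type.
  by rewrite rmorph0 mul0r.
rewrite addr0.
rewrite (bigID (fun w : 'S_(psize mu) => cycle_type w == mu)) /=.
rewrite [X in _ + X]big1 => [|w /negbTE ne_w]; last first.
  by rewrite ffunE ne_w rmorph0 mul0r.
rewrite addr0 (eq_bigr (fun=> f_ mu la / (class_size mu)%:R)); last first.
  by move=> w /eqP mu_w; rewrite ffunE mu_w eqxx rmorph1 mul1r.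
rewrite sumr_const (_ : #|_| = class_size mu); last first.
  by apply: eq_card => w; rewrite !inE.
have [C0|C_neq0] := eqVneq (class_size mu) 0%N.
  by rewrite C0 mulr0n /f_ C0 mulr0 !mul0r if_same.
by rewrite -[LHS]mulr_natr divfK // pnatr_eq0.
Qed.

(* B_n is the n-th entry, from B_0 = 1 and                                   *)
(* sum_(j <= m) binomial(m + 1, j) B_j = 0 for m > 0; B_1 = -1/2.            *)
Fixpoint bernoulli_seq (n : nat) : seq rat :=
  if n isn't m.+1 then [::] else
  let s := bernoulli_seq m in
  rcons s (((m == 0)%N%:R - \sum_(j < m) 'C(m.+1, j)%:R * s`_j) / m.+1%:R).

Definition bernoulli (n : nat) : rat := (bernoulli_seq n.+1)`_n.

(* The value zeta(-k) of the Riemann zeta function at a negative integer,    *)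
(* k >= 1: zeta(-k) = - B_(k+1) / (k+1).                                     *)
Definition zeta_neg (k : nat) : rat := - bernoulli k.+1 / k.+1%:R.

(* [i] runs from 0, so the usual lambda_i - i + 1/2 reads                    *)
(* lambda`_i - i.+1 + 1/2; the terms with i >= l(lambda) vanish.             *)
Definition p_ (k : nat) (la : intpart) : rat :=
  \sum_(i < size la)
     (((nth 0%N la i)%:R - i.+1%:R + 2^-1) ^+ k - (- i.+1%:R + 2^-1) ^+ k)
  + (1 - 2 ^- k) * zeta_neg k.

Definition phi_inv (f : intpart -> algC) : grpalgs :=
  epsilon (inhabits (fun d => 0 : grpalg d))
    (fun x => in_sum_centers x /\ phi x =1 f).

Definition completed_cycle (k : nat) : grpalgs :=
  fun d => [ffun w => k%:R^-1 * phi_inv (fun la => ratr (p_ k la)) d w].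

(* x = sum_mu r_mu (mu), a finite linear combination *)
Definition class_expansion (x : grpalgs) (r : {fsfun intpart -> rat with 0}) :=
  forall d (w : 'S_d), x d w = \sum_(mu <- finsupp r) r mu * class_sum mu d w.

Definition completion_coeffs (k : nat) : {fsfun intpart -> rat with 0} :=
  epsilon (inhabits [fsfun]) (class_expansion (completed_cycle k)).

Definition rho (k : nat) (mu : intpart) : rat := completion_coeffs k mu.

Definition pser := nat -> rat.

Definition pser_one : pser := fun n => (n == 0)%N%:R.

Definition pser_mul (a b : pser) : pser :=
  fun n => \sum_(i < n.+1) a i * b (n - i)%N.

(* The first n coefficients of the inverse of a series with a_0 <> 0. *)
Fixpoint pser_inv_seq (a : pser) (n : nat) : seq rat :=
  if n isn't m.+1 then [::] else
  let s := pser_inv_seq a m in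
  rcons s (((m == 0)%N%:R - \sum_(i < m) s`_i * a (m - i)%N) / a 0%N).

Definition pser_inv (a : pser) : pser := fun n => (pser_inv_seq a n.+1)`_n.

Definition pser_exp (a : pser) (n : nat) : pser := iter n (pser_mul a) pser_one.

Definition pser_expz (a : pser) (m : int) : pser :=
  match m with
  | Posz n => pser_exp a n
  | Negz n => pser_exp (pser_inv a) n.+1
  end.

(* a(c z) *)
Definition pser_scale (c : rat) (a : pser) : pser := fun n => c ^+ n * a n.

(* sinh(z/2) *)
Definition sinh_half : pser :=
  fun n => if odd n then (2 ^+ n * n`!%:R)^-1 else 0.

(* S(z) = sinh(z/2) / (z/2) *)
Definition S_ser : pser := fun n => 2 * sinh_half n.+1.

(* [z^j] a, zero for j < 0 *)
Definition pser_coef (j : int) (a : pser) : rat :=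
  if j is Posz n then a n else 0.

(* Main.v *)
(** Write s(t) = 2 sinh (t/2). For a partial permutation w of a set D of size d
    put t_D(w) = s(z)^(d-2) prod_c s(c z) / d!, over the cycle lengths c of w.
    If J_x is the sum of the transpositions (a x) with a < x, then
    e^(z J_x) = sum t_D(w) w over the partial permutations with max D = x:
    both sides solve the same linear differential equation, because multiplying
    by (a x) joins two cycles, cuts a cycle or adds the point a to D.
    On the other hand the Young symmetrizer of lambda is an eigenvector of the
    power sums of J_1, ..., J_n, with the contents of lambda as J-values, and
    s(z) sum_x e^(z c_x) + 1/s(z) generates the numbers p_k(lambda) / k!, up to
    the pole 1/z. Taking central characters, s(z) t_D(w) is the generating
    series of the completion coefficients; the empty partition accounts for
    1/s(z), i.e. for the zeta value. The coefficients are unique since phi is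
    injective: inductively, the degree d part of x is determined by the values
    of phi x on the partitions of d, as every irreducible character of S_d is
    some chi^lambda. *)
Require Import Defs.
From HB Require Import structures.
From mathcomp Require Import all_boot all_order all_fingroup all_algebra.
From mathcomp Require Import all_field all_character finmap.
From mathcomp Require boolp.
From mathcomp Require Import ring zify.
From Stdlib Require Import ClassicalEpsilon.
Import Order.TTheory GRing.Theory Num.Theory.

Set Implicit Arguments.
Unset Strict Implicit.
Unset Printing Implicit Defensive.

Local Open Scope ring_scope.

(** * The ring of power series *)

(** A single J_x need not be central, so only sums over x can be compared with characters. The extra
    factor s(z) serves two purposes. It makes the coefficient of a pair (D, w) independent of the
    maximal point of D, so that the sum over x runs once over every nonempty D and is invariant
    under conjugation. It also turns e^(z c) into the generating function of (c + 1/2)^k - (c -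
    1/2)^k, which telescopes along each row of the diagram.

    The obstacle on the other side is that chi^lambda is given only as a common constituent of two
    induced characters, without a basis. Eigenvalues are therefore read off between the row sum A
    and the signed column sum B, from A J_x^k B = c_x^k A B. This needs A B to be nonzero in that
    constituent. Both this fact and the injectivity of the labelling come from comparing the total
    of the column numbers of a tableau with that of other fillings, a numerical substitute for the
    dominance order. *)

(* Ring laws and the Leibniz rule are imported from polynomials by truncation. *)
Definition pser_trunc (n : nat) (a : pser) : {poly rat} := \poly_(i < n) a i.

Lemma coef_pser_trunc_mul N n (a b : pser) :
  (n < N)%N -> (pser_trunc N a * pser_trunc N b)`_n = pser_mul a b n.
Proof.
move=> ltnN; rewrite coefM; apply: eq_bigr => i _.
by rewrite !coef_poly (leq_ltn_trans _ ltnN) ?(leq_ltn_trans _ ltnN) ?leq_subr // -ltnS.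
Qed.

Lemma pser_mulA : associative pser_mul.
Proof.
move=> a b c; apply: boolp.funext => n; pose tr := pser_trunc n.+1.
suff [-> ->] : pser_mul a (pser_mul b c) n = (tr a * (tr b * tr c))`_n /\
   pser_mul (pser_mul a b) c n = (tr a * tr b * tr c)`_n by rewrite mulrA.
split; rewrite coefM; apply: eq_bigr => i _.
  by rewrite -(@coef_pser_trunc_mul n.+1) ?ltnS ?leq_subr // coef_poly ltn_ord.
by rewrite -(@coef_pser_trunc_mul n.+1) // coef_poly ltnS leq_subr.
Qed.

Lemma pser_mulC : commutative pser_mul.
Proof.
by move=> a b; apply: boolp.funext => n; rewrite -!(@coef_pser_trunc_mul n.+1) // mulrC.
Qed.

Lemma pser_mul1 : left_id pser_one pser_mul.
Proof.
move=> a; apply: boolp.funext => n; rewrite /pser_mul big_ord_recl /= mul1r subn0.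
by rewrite big1 ?addr0 // => i _; rewrite mul0r.
Qed.

Definition pser_add (a b : pser) : pser := fun n => a n + b n.
Definition pser_opp (a : pser) : pser := fun n => - a n.

Lemma pser_addA : associative pser_add.
Proof. by move=> a b c; apply: boolp.funext => n; apply: addrA. Qed.

Lemma pser_addC : commutative pser_add.
Proof. by move=> a b; apply: boolp.funext => n; apply: addrC. Qed.

Lemma pser_add0 : left_id (fun=> 0 : rat) pser_add.
Proof. by move=> a; apply: boolp.funext => n; apply: add0r. Qed.

Lemma pser_addN : left_inverse (fun=> 0 : rat) pser_opp pser_add.
Proof. by move=> a; apply: boolp.funext => n; apply: addNr. Qed.

Lemma pser_mulDl : left_distributive pser_mul pser_add.
Proof.
move=> a b c; apply: boolp.funext => n; rewrite /pser_add /pser_mul -big_split.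
by apply: eq_bigr => i _; rewrite mulrDl.
Qed.

HB.instance Definition _ := boolp.gen_eqMixin pser.
HB.instance Definition _ := boolp.gen_choiceMixin pser.
HB.instance Definition _ := GRing.isZmodule.Build pser pser_addA pser_addC pser_add0 pser_addN.

Lemma pser_one_neq0 : pser_one != (0 : pser).
Proof. by apply/eqP => /(congr1 (fun a : pser => a 0%N)). Qed.

HB.instance Definition _ := GRing.Zmodule_isComNzRing.Build pser
  pser_mulA pser_mulC pser_mul1 pser_mulDl pser_one_neq0.

Lemma pser_coefD (a b : pser) n : (a + b) n = a n + b n. Proof. by []. Qed.

Lemma pser_coefB (a b : pser) n : (a - b) n = a n - b n. Proof. by []. Qed.

Lemma pser_coefM (a b : pser) n : (a * b) n = \sum_(i < n.+1) a i * b (n - i)%N.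
Proof. by []. Qed.

Lemma pser_coef1 n : (1 : pser) n = (n == 0)%N%:R. Proof. by []. Qed.

Lemma pser_coef_sum I (r : seq I) P (F : I -> pser) n :
  (\sum_(i <- r | P i) F i) n = \sum_(i <- r | P i) F i n.
Proof. exact: (big_morph (fun a : pser => a n)). Qed.

Lemma pserP (a b : pser) : (forall n, a n = b n) -> a = b.
Proof. exact: boolp.funext. Qed.

Definition pser_const (c : rat) : pser := fun n => if n is 0%N then c else 0.
Lemma pser_const_is_zmod_morphism : zmod_morphism pser_const.
Proof. by move=> a b; apply: pserP => -[|n] //=; rewrite pser_coefB subr0. Qed.

Lemma pser_coefZ c (a : pser) n : (pser_const c * a) n = c * a n.
Proof.
by rewrite pser_coefM big_ord_recl subn0 big1 ?addr0 // => i _; rewrite mul0r.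
Qed.

Lemma pser_const_is_monoid_morphism : monoid_morphism pser_const.
Proof.
split=> [|a b]; apply: pserP => n; first by case: n.
by rewrite pser_coefZ; case: n => //= n; rewrite mulr0.
Qed.

HB.instance Definition _ := GRing.isZmodMorphism.Build rat pser pser_const
  pser_const_is_zmod_morphism.
HB.instance Definition _ := GRing.isMonoidMorphism.Build rat pser pser_const
  pser_const_is_monoid_morphism.

Definition pser_deriv (a : pser) : pser := fun n => n.+1%:R * a n.+1.
Lemma pser_deriv_is_zmod_morphism : zmod_morphism pser_deriv.
Proof. by move=> a b; apply: pserP => n; rewrite /pser_deriv !pser_coefB mulrBr. Qed.

HB.instance Definition _ := GRing.isZmodMorphism.Build pser pser pser_deriv
  pser_deriv_is_zmod_morphism.

Lemma pser_derivM (a b : pser) :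
  pser_deriv (a * b) = pser_deriv a * b + a * pser_deriv b.
Proof.
apply: pserP => n; pose tr := pser_trunc n.+2.
have trD c i : (i <= n)%N -> (tr c)^`()`_i = pser_deriv c i.
  by move=> le_in; rewrite coef_deriv coef_poly ltnS ltnS le_in /pser_deriv mulr_natl.
transitivity ((tr a * tr b)^`()`_n).
  by rewrite coef_deriv coef_pser_trunc_mul // /pser_deriv mulr_natl.
rewrite derivM coefD pser_coefD !coefM !pser_coefM; congr (_ + _).
  apply: eq_bigr => i _; rewrite trD -1?ltnS // coef_poly ifT // ltnS.
  by rewrite (leq_trans (leq_subr _ _)).
apply: eq_bigr => i _; rewrite trD ?leq_subr // coef_poly ifT //.
by rewrite (leq_trans (ltn_ord i)).
Qed.

Lemma pser_deriv_const c : pser_deriv (pser_const c) = 0.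
Proof. by apply: pserP => n; rewrite /pser_deriv mulr0. Qed.

Lemma pser_derivZ c (a : pser) :
  pser_deriv (pser_const c * a) = pser_const c * pser_deriv a.
Proof. by rewrite pser_derivM pser_deriv_const mul0r add0r. Qed.

Lemma pser_deriv1 : pser_deriv 1 = 0.
Proof. by rewrite -(rmorph1 pser_const) pser_deriv_const. Qed.

Lemma pser_derivX (a : pser) n : pser_deriv (a ^+ n) = n%:R * a ^+ n.-1 * pser_deriv a.
Proof.
elim: n => [|[|n] IHn]; first by rewrite pser_deriv1 !mul0r.
  by rewrite expr1 mul1r expr0 mul1r.
by rewrite exprS pser_derivM IHn /= [in RHS]mulrS exprS; ring.
Qed.

Lemma pser_deriv_prod (I : finType) (A : {set I}) (F : I -> pser) :
  pser_deriv (\prod_(i in A) F i) =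
  \sum_(i in A) pser_deriv (F i) * \prod_(j in A :\ i) F j.
Proof.
have [n leAn] := ubnP #|A|; elim: n A leAn => // n IHn A /ltnSE-leAn.
have [->|[i0 Ai0]] := set_0Vmem A.
  by rewrite !big_set0 pser_deriv1.
rewrite (big_setD1 i0) //= pser_derivM IHn; last first.
  by rewrite (leq_trans _ leAn) // [X in (_ < X)%N](cardsD1 i0) Ai0.
rewrite [in RHS](big_setD1 i0) //=; congr (_ + _).
rewrite mulr_sumr; apply: eq_bigr => i; rewrite !inE => /andP[ne_i Ai].
rewrite [in RHS](big_setD1 i0) ?inE 1?eq_sym ?ne_i //=.
by rewrite mulrCA setDDl setUC -setDDl.
Qed.

Definition pser_expc (a : rat) : pser := fun n => a ^+ n / n`!%:R.

Lemma pser_deriv_expc a : pser_deriv (pser_expc a) = pser_const a * pser_expc a.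
Proof.
apply: pserP => n; rewrite pser_coefZ /pser_deriv /pser_expc exprS factS natrM.
have n1 : n.+1%:R != 0 :> rat by rewrite pnatr_eq0.
have nf : n`!%:R != 0 :> rat by rewrite pnatr_eq0 -lt0n fact_gt0.
move: n1 nf; move: (n.+1%:R : rat) (n`!%:R : rat) => u v u0 v0.
by field; rewrite v0 u0.
Qed.

Lemma pser_expcD a b : pser_expc (a + b) = pser_expc a * pser_expc b.
Proof.
apply: pserP => n; rewrite pser_coefM /pser_expc addrC exprDn mulr_suml.
apply: eq_bigr => i _; have le_in : (i <= n)%N by rewrite -ltnS.
have nf m : m`!%:R != 0 :> rat by rewrite pnatr_eq0 -lt0n fact_gt0.
rewrite -(bin_fact le_in) !natrM -mulr_natr.
have bn : 'C(n, i)%:R != 0 :> rat by rewrite pnatr_eq0 -lt0n bin_gt0.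
by field; rewrite !nf bn.
Qed.

Lemma pser_expc0 : pser_expc 0 = 1.
Proof.
by apply: pserP => -[|n]; rewrite /pser_expc expr0n /= ?mul0r // fact0 divr1.
Qed.

Lemma pser_expcMn a n : pser_expc (a *+ n) = pser_expc a ^+ n.
Proof.
by elim: n => [|n IHn]; rewrite ?mulr0n ?pser_expc0 // mulrS pser_expcD IHn exprS.
Qed.

(** * The join-cut equation *)

Definition half : pser := pser_const 2^-1.
Definition exph : pser := pser_expc 2^-1.
Definition exphN : pser := pser_expc (- 2^-1).

Lemma halfE : half * 2 = 1.
Proof. by rewrite -(rmorph_nat pser_const) -rmorphM mulVf ?rmorph1. Qed.

Lemma exph_mulV : exph * exphN = 1.
Proof. by rewrite -pser_expcD subrr pser_expc0. Qed.

(* [sh2 c = 2 sinh (c z / 2)], [ch c = cosh (c z / 2)] and                   *)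
(* [shq b = sinh (b z / 2) / sinh (z / 2)].                                  *)
Definition sh2 (c : nat) : pser := exph ^+ c - exphN ^+ c.
Definition ch (c : nat) : pser := half * (exph ^+ c + exphN ^+ c).
Definition shq (b : nat) : pser := \sum_(i < b) exph ^+ (b.-1 - i) * exphN ^+ i.

Lemma sh2_shq b : sh2 1 * shq b = sh2 b.
Proof. by rewrite /sh2 [RHS]subrXX !expr1. Qed.

Lemma shq1 : shq 1 = 1.
Proof. by rewrite /shq big_ord_recl big_ord0 addr0 mulr1. Qed.

Lemma shqSr b : shq b.+1 = exph * shq b + exphN ^+ b.
Proof.
rewrite /shq big_ord_recr /= subnn mul1r mulr_sumr; congr (_ + _).
apply: eq_bigr => i _; rewrite mulrA -exprS; congr (exph ^+ _ * _).
by have := ltn_ord i; lia.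
Qed.

Lemma shqSl b : shq b.+1 = exphN * shq b + exph ^+ b.
Proof.
rewrite /shq big_ord_recl /= subn0 mulr1 addrC mulr_sumr; congr (_ + _).
apply: eq_bigr => i _; rewrite /bump add1n exprS [in RHS]mulrCA; congr (exph ^+ _ * _).
by have := ltn_ord i; lia.
Qed.

(** The formula for sinh(x - y), divided by sinh(z/2). The two recursions for [shq] replace the
    cancellation of [sh2 1]. *)
Lemma shq_pred b : shq b = shq b.+1 * ch 1 - ch b.+1.
Proof.
have uv := exph_mulV; have h2 := halfE.
have e1 : exphN * shq b.+1 = shq b + exphN ^+ b.+1.
  by rewrite shqSr exprS mulrDr mulrA [exphN * _]mulrC uv mul1r.
have e2 : exph * shq b.+1 = shq b + exph ^+ b.+1.
  by rewrite shqSl exprS mulrDr mulrA uv mul1r.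
rewrite /ch !expr1; transitivity (half * (2 * shq b)).
  by rewrite mulrA h2 mul1r.
have -> : shq b.+1 * (half * (exph + exphN)) =
  half * (exph * shq b.+1 + exphN * shq b.+1) by ring.
by rewrite e1 e2; ring.
Qed.

Lemma sh2D b c : sh2 (b + c) = sh2 b * ch c + ch b * sh2 c.
Proof.
rewrite /sh2 /ch !exprD -[LHS]mul1r -halfE; ring.
Qed.

(** Product-to-sum: each product is 2 cosh of the sum minus 2 cosh of the difference of the
    arguments. The sums are all (b + 1) z/2, and the exponentials of the differences form the
    geometric sum [shq b] twice, once in reversed order. *)
Lemma sh2_conv b :
  \sum_(i < b) sh2 i.+1 * sh2 (b - i) = 2 * b%:R * ch b.+1 - 2 * shq b.
Proof.
have uv := exph_mulV; have h2 := halfE.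
transitivity (\sum_(i < b) ((exph ^+ b.+1 + exphN ^+ b.+1)
   - (exph ^+ (b.-1 - i) * exphN ^+ i
      + exph ^+ (b.-1 - rev_ord i) * exphN ^+ (rev_ord i)))).
  apply: eq_bigr => i _.
  have lt_ib := ltn_ord i.
  have -> : (rev_ord i : nat) = (b - i.+1)%N by [].
  have -> : (b.-1 - (b - i.+1) = i)%N by lia.
  have -> : (b.-1 - i = b - i.+1)%N by lia.
  have -> : (b.+1 = i.+1 + (b - i.+1).+1)%N by lia.
  have -> : (b - i = (b - i.+1).+1)%N by lia.
  move: (nat_of_ord i) (b - i.+1)%N => n m; rewrite /sh2 !exprD !exprS.
  have e1 : exph * exph ^+ n * (exphN * exphN ^+ m) = exph ^+ n * exphN ^+ m.
    by rewrite mulrACA uv mul1r.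
  have e2 : exph * exph ^+ m * (exphN * exphN ^+ n) = exph ^+ m * exphN ^+ n.
    by rewrite mulrACA uv mul1r.
  by rewrite -e1 -e2; ring.
rewrite sumrB sumr_const card_ord big_split /=.
rewrite -/(shq b) (reindex_inj rev_ord_inj) /=.
have -> : \sum_(j < b) exph ^+ (b.-1 - rev_ord (rev_ord j)) * exphN ^+ rev_ord (rev_ord j)
   = shq b by apply: eq_bigr => i _; rewrite rev_ordK.
rewrite /ch -[X in X - _]mulr_natr.
have -> : 2 * b%:R * (half * (exph ^+ b.+1 + exphN ^+ b.+1)) =
  half * 2 * (exph ^+ b.+1 + exphN ^+ b.+1) * b%:R by ring.
by rewrite h2; ring.
Qed.

Lemma pser_deriv_sh2 c : pser_deriv (sh2 c) = c%:R * ch c.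
Proof.
rewrite /sh2 raddfB /= !pser_derivX !pser_deriv_expc rmorphN -/half -/exph -/exphN.
rewrite /ch; case: c => [|c] /=; first by rewrite !mul0r subr0.
by rewrite !exprS; ring.
Qed.

Lemma sh2_mul_deriv_shq b : sh2 1 * pser_deriv (shq b) = b%:R * ch b - ch 1 * shq b.
Proof.
have := congr1 pser_deriv (sh2_shq b).
by rewrite pser_derivM !pser_deriv_sh2 mul1r => <-; ring.
Qed.

(* The first sum joins the cycle of length [b.+1] with another one, the      *)
(* second cuts it, and the last term cuts off a fixed point.                 *)
Lemma join_cut_ode (T : finType) (P : {set T}) (f : T -> nat) (b e : nat) :
  (e.+2 = b.+1 + \sum_(B in P) f B)%N ->
  pser_deriv (sh2 1 ^+ e.+1 * shq b.+1 * \prod_(B in P) sh2 (f B)) =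
  sh2 1 ^+ e.+1 *
    (\sum_(B in P) (f B)%:R * (shq (b.+1 + f B) * \prod_(B' in P :\ B) sh2 (f B'))
     + (\sum_(i < b) shq i.+1 * sh2 (b - i)) * \prod_(B in P) sh2 (f B))
  + e.+2%:R * (sh2 1 ^+ e * shq b * \prod_(B in P) sh2 (f B)).
Proof.
move=> def_e; set Pi := \prod_(B in P) _; set s := sh2 1.
(* By the addition formula for [sh2 (b.+1 + f B)], joining splits in two: one part is the product
   rule for [Pi], the other only counts the points outside the cycle of length [b.+1]. *)
have join : s ^+ e.+1 *
    (\sum_(B in P) (f B)%:R * (shq (b.+1 + f B) * \prod_(B' in P :\ B) sh2 (f B')))
  = s ^+ e.+1 * shq b.+1 * pser_deriv Pi
    + (\sum_(B in P) f B)%:R * (s ^+ e * ch b.+1 * Pi).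
  rewrite pser_deriv_prod [LHS]mulr_sumr natr_sum [X in _ + X]mulr_suml.
  rewrite [X in X + _]mulr_sumr -big_split /=.
  apply: eq_bigr => B PB; rewrite pser_deriv_sh2.
  rewrite /Pi (big_setD1 B PB) /= exprS; set Q := \prod_(j in _) _.
  have -> : s * s ^+ e * ((f B)%:R * (shq (b.+1 + f B) * Q)) =
    s ^+ e * ((f B)%:R * (s * shq (b.+1 + f B) * Q)) by ring.
  rewrite sh2_shq sh2D -(sh2_shq b.+1) -/s; ring.
rewrite mulrDr join !pser_derivM pser_derivX pser_deriv_sh2 mul1r /=.
have cut : s * \sum_(i < b) shq i.+1 * sh2 (b - i) = 2 * b%:R * ch b.+1 - 2 * shq b.
  rewrite -sh2_conv mulr_sumr; apply: eq_bigr => i _.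
  by rewrite mulrA sh2_shq.
set W := \sum_(i < b) _ in cut *.
have dq := sh2_mul_deriv_shq b.+1; rewrite -/s in dq.
have sumf : (\sum_(B in P) f B)%:R = e%:R + 2 - b.+1%:R :> pser.
  by rewrite -(natrD _ e 2) addn2 def_e natrD addrAC subrr add0r.
rewrite sumf.
have -> : (e.+2)%:R = e%:R + 2 :> pser by rewrite -[e.+2]addn2 natrD.
have -> : (e.+1)%:R = e%:R + 1 :> pser by rewrite -[e.+1]addn1 natrD.
have -> : (b.+1)%:R = b%:R + 1 :> pser by rewrite -[b.+1]addn1 natrD.
have eb : (b.+1)%:R = b%:R + 1 :> pser by rewrite -[b.+1]addn1 natrD.
rewrite eb in dq.
set D' := pser_deriv (shq _) in dq *; set Dp := pser_deriv Pi.
(* Both sides share the term in [Dp] and the factor [s ^+ e * Pi]. The rest is linear in [s * D']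
   and [s * W], which [dq] and [cut] evaluate. *)
transitivity (s ^+ e.+1 * shq b.+1 * Dp + s ^+ e * Pi *
   ((e%:R + 1) * ch 1 * shq b.+1 + s * D')); first by rewrite exprS; ring.
rewrite dq; transitivity (s ^+ e.+1 * shq b.+1 * Dp + s ^+ e * Pi *
   ((e%:R + 2 - (b%:R + 1)) * ch b.+1 + s * W + (e%:R + 2) * shq b)); last first.
  by rewrite exprS; ring.
by rewrite cut (shq_pred b); ring.
Qed.

(** * Joining and cutting cycles by a transposition *)

Section JoinCut.
Variable T : finType.
Implicit Types (s w : {perm T}) (a x y z : T) (D B : {set T}).

Lemma tperm_mulK a x s : (tperm a x * (tperm a x * s) = s)%g.
Proof. by rewrite mulgA tperm2 mul1g. Qed.

Lemma porbit_mul_tperm_id s a x y : a \notin porbit s y -> x \notin porbit s y ->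
  porbit (tperm a x * s) y = porbit s y.
Proof.
move=> nay nxy; have eq_pow i : ((tperm a x * s) ^+ i)%g y = (s ^+ i)%g y.
  elim: i => [|i IHi]; first by rewrite !expg0 !perm1.
  rewrite !expgSr !permM IHi tpermD //.
    by apply: contraNneq nay => ->; apply: mem_porbit.
  by apply: contraNneq nxy => ->; apply: mem_porbit.
apply/setP => z; apply/porbitP/porbitP => -[i ->]; exists i.
  exact: eq_pow.
exact/esym/eq_pow.
Qed.

(** Multiplication by the transposition changes the number of cycles by one, up or down according to
    whether [a] and [x] share a cycle. Doing it twice restores the number, so the two answers are
    opposite. *)
Lemma mem_porbit_mul_tperm s a x : a != x ->
  (x \in porbit (tperm a x * s) a) = (x \notin porbit s a).
Proof.
move=> ne_ax; have := porbits_mul_tperm s a x.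
have /= := porbits_mul_tperm (tperm a x * s)%g a x.
rewrite tperm_mulK ne_ax ![(a \in porbit _ x)]porbit_sym.
by case: (x \in porbit s a); case: (x \in _) => //=; lia.
Qed.

Lemma porbitU_mul_tperm s a x :
  porbit (tperm a x * s) a :|: porbit (tperm a x * s) x = porbit s a :|: porbit s x.
Proof.
wlog suff sub : s / porbit s a :|: porbit s x
    \subset porbit (tperm a x * s) a :|: porbit (tperm a x * s) x.
  apply/eqP; rewrite eqEsubset sub andbT.
  by have := sub (tperm a x * s)%g; rewrite tperm_mulK.
apply/subsetP => y; apply: contraLR; rewrite !inE !negb_or => /andP[na nx].
rewrite !(porbit_sym _ y) in na nx *.
by have := porbit_mul_tperm_id na nx; rewrite tperm_mulK => ->; rewrite na nx.
Qed.

(** A partial permutation is encoded as a set [D] with a permutation of the whole type supported in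
    [D]. Fixed points inside [D] count as cycles, those outside do not. *)
Definition orbs D s x := [set B in porbits s | (B \subset D) && (x \notin B)].

Lemma in_orbs D s x B :
  (B \in orbs D s x) = [&& B \in porbits s, B \subset D & x \notin B].
Proof. by rewrite inE. Qed.

Lemma orbs_join D s a x : a != x -> a \notin porbit s x ->
  orbs D (tperm a x * s) x = orbs D s x :\ porbit s a.
Proof.
move=> ne_ax na; have xa : x \in porbit (tperm a x * s) a.
  by rewrite mem_porbit_mul_tperm // porbit_sym.
apply/setP => B; rewrite !(in_orbs, inE).
case: (B \subset D); rewrite /= ?andbF //.
apply/andP/and3P => [[/imsetP[y _ ->] nx]|[neq /imsetP[y _ defB] nx]].
  have na' : a \notin porbit (tperm a x * s) y.
    apply: contra nx; rewrite -eq_porbit_mem => /eqP <- //.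
  have eqy := porbit_mul_tperm_id na' nx; rewrite tperm_mulK in eqy.
  rewrite -eqy imset_f //; split=> //; last by rewrite eqy.
  by apply: contraNneq na' => e; rewrite -eqy e porbit_id.
split=> //; have na' : a \notin porbit s y.
  by apply: contra neq; rewrite defB -eq_porbit_mem => /eqP ->.
by rewrite defB -(@porbit_mul_tperm_id s a x) -?defB // ?imset_f // defB.
Qed.

Lemma card_porbit_join s a x : a != x -> a \notin porbit s x ->
  #|porbit (tperm a x * s) x| = (#|porbit s x| + #|porbit s a|)%N.
Proof.
move=> ne_ax na; have xa : x \in porbit (tperm a x * s) a.
  by rewrite mem_porbit_mul_tperm // porbit_sym.
have := porbitU_mul_tperm s a x; rewrite -eq_porbit_mem in xa.
rewrite -(eqP xa) setUid => ->.
rewrite cardsU disjoint_setI0 ?cards0 ?subn0 1?addnC //.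
rewrite disjoints_subset; apply/subsetP => y ya; rewrite inE.
apply: contra na; rewrite -eq_porbit_mem in ya => yx.
by rewrite -eq_porbit_mem -(eqP ya) eq_porbit_mem.
Qed.

(** A cut of [s] is a join of [tperm a x * s] read backwards. *)
Lemma orbs_cut D s a x : a != x -> a \in porbit s x ->
    porbit (tperm a x * s) a \subset D ->
  orbs D (tperm a x * s) x = porbit (tperm a x * s) a |: orbs D s x /\
  porbit (tperm a x * s) a \notin orbs D s x.
Proof.
move=> ne_ax a_x subD; have na : a \notin porbit (tperm a x * s) x.
  by rewrite porbit_sym mem_porbit_mul_tperm // negbK porbit_sym.
have := orbs_join D ne_ax na; rewrite tperm_mulK => ->.
by rewrite setD1K ?setD11 // in_orbs imset_f //= subD porbit_sym.
Qed.

Lemma perm_pow_inj s x i j : (i < #|porbit s x|)%N -> (j < #|porbit s x|)%N ->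
  (s ^+ i)%g x = (s ^+ j)%g x -> i = j.
Proof.
move=> lti ltj; rewrite !permX => e.
have := uniq_traject_porbit s x => /uniqP-/(_ x i j).
by rewrite !inE !size_traject !nth_traject //; apply.
Qed.

(** Following powers from [a] meets s x, ..., s^j x, and from [x] the remaining points of the old
    cycle. This gives lower bounds for both lengths, which are sharp because the two new cycles are
    disjoint and fill the old one. *)
Lemma card_porbit_cut s x j (a := (s ^+ j)%g x) :
  (0 < j < #|porbit s x|)%N ->
  #|porbit (tperm a x * s) a| = j /\ #|porbit (tperm a x * s) x| = (#|porbit s x| - j)%N.
Proof.
case/andP=> j_gt0 lt_jb; set b := #|porbit s x| in lt_jb *.
pose t := (tperm a x * s)%g.
have ne_ax : a != x.
  apply/eqP => eq_ax; have := @perm_pow_inj s x j 0%N lt_jb (ltn_trans j_gt0 lt_jb).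
  by rewrite expg0 perm1 => /(_ eq_ax) j0; rewrite j0 in j_gt0.
have inj := perm_pow_inj.
have pow_a m : (m < j)%N -> (t ^+ m.+1)%g a = (s ^+ m.+1)%g x.
  elim: m => [|m IHm] lt_mj; first by rewrite !expg1 permM tpermL.
  rewrite expgSr permM IHm 1?ltnW // permM tpermD -?permM -?expgSr //.
    apply/eqP => e; have := inj s x j m.+1 lt_jb (ltn_trans lt_mj lt_jb) e.
    by move=> ejm; rewrite ejm ltnn in lt_mj.
  apply/eqP => e; have := inj s x 0%N m.+1 (ltn_trans j_gt0 lt_jb) (ltn_trans lt_mj lt_jb).
  by rewrite expg0 perm1 => /(_ e).
have pow_x m : (m < b - j)%N -> (t ^+ m.+1)%g x = (s ^+ (j + m).+1)%g x.
  elim: m => [|m IHm] lt_m; first by rewrite expg1 permM tpermR addn0 expgSr permM.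
  have lt_m1 : ((j + m).+1 < b)%N by lia.
  rewrite expgSr permM IHm 1?ltnW // permM tpermD -?permM -?expgSr -?addnS //.
    apply/eqP => e; have : j = (j + m).+1 by apply: (inj s x) => //; rewrite -addnS.
    by lia.
  apply/eqP => e; have // : 0%N = (j + m).+1.
  by apply: (inj s x) => //; rewrite ?(ltn_trans j_gt0) // expg0 perm1 -addnS.
have le_a : (j <= #|porbit t a|)%N.
  rewrite -[leqLHS]card_ord -(@card_in_imset _ _ (fun i : 'I_j => (t ^+ i.+1)%g a)).
    by apply/subset_leq_card/subsetP => _ /imsetP[i _ ->]; apply: mem_porbit.
  move=> i i' _ _ /=; rewrite !pow_a // !expgSr !permM => /perm_inj e.
  by apply/val_inj/(inj s x i i') => //; apply: ltn_trans lt_jb.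
have le_x : (b - j <= #|porbit t x|)%N.
  rewrite -[leqLHS]card_ord -(@card_in_imset _ _ (fun i : 'I_(b - j) => (t ^+ i.+1)%g x)).
    by apply/subset_leq_card/subsetP => _ /imsetP[i _ ->]; apply: mem_porbit.
  move=> i i' _ _ /=; rewrite !pow_x // !expgSr !permM => /perm_inj e.
  have [lti lti'] := (ltn_ord i, ltn_ord i').
  apply/val_inj/eqP; rewrite -(eqn_add2l j); apply/eqP/(inj s x) => //=; rewrite -/b; lia.
have a_x : a \in porbit s x by apply: mem_porbit.
have sum_b : (#|porbit t a| + #|porbit t x| = b)%N.
  have := porbitU_mul_tperm s a x; rewrite -/t -[b]/#|porbit s x|.
  have /eqP-> : porbit s a == porbit s x by rewrite eq_porbit_mem.
  rewrite setUid => <-.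
  rewrite cardsU disjoint_setI0 ?cards0 ?subn0 //.
  rewrite disjoints_subset; apply/subsetP => y ya; rewrite inE; apply/negP => yx.
  have := mem_porbit_mul_tperm s ne_ax; rewrite -/t porbit_sym -eq_porbit_mem.
  rewrite -!eq_porbit_mem in ya yx; rewrite -(eqP ya) (eqP yx) eqxx.
  by rewrite porbit_sym a_x.
by rewrite -/t; move: le_a le_x sum_b lt_jb; clearbody b; split; lia.
Qed.

Lemma sum_porbit (R : nmodType) s x (F : T -> R) :
  \sum_(a in porbit s x) F a = \sum_(i < #|porbit s x|) F ((s ^+ i)%g x).
Proof.
rewrite (eq_bigl _ _ (porbit_traject s x)) -big_uniq ?uniq_traject_porbit //=.
rewrite (big_nth x) size_traject big_mkord; apply: eq_bigr => i _.
by rewrite nth_traject // permX.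
Qed.

Lemma perm_on_porbit D s x : perm_on D s -> x \in D -> porbit s x \subset D.
Proof.
move=> sD xD; apply/subsetP => _ /porbitP[i ->].
by elim: i => [|i IHi]; rewrite ?expg0 ?perm1 // expgSr permM perm_closed.
Qed.

Lemma sum_orbs (R : nmodType) D s x (F : {set T} -> R) : perm_on D s -> x \in D ->
  \sum_(a in D :\: porbit s x) F (porbit s a) = \sum_(B in orbs D s x) F B *+ #|B|.
Proof.
move=> sD xD; rewrite (partition_big (porbit s) (mem (orbs D s x))) /=; last first.
  move=> a; rewrite in_setD => /andP[na aD].
  by rewrite [_ \in _]in_orbs imset_f ?perm_on_porbit // porbit_sym.
apply: eq_bigr => B; rewrite in_orbs => /and3P[/imsetP[y _ ->] sub nx].
rewrite (eq_bigr (fun=> F (porbit s y))); last by move=> a /andP[_ /eqP->].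
rewrite sumr_const; congr (_ *+ _); apply: eq_card => a.
rewrite unfold_in /= !inE eq_porbit_mem andbC.
have [ay /=|//] := boolP (a \in porbit s y); rewrite (subsetP sub _ ay) andbT.
apply: contra nx; rewrite -!eq_porbit_mem in ay *.
by rewrite -(eqP ay) eq_sym.
Qed.

Lemma card_orbs D s x : perm_on D s -> x \in D ->
  #|D| = (#|porbit s x| + \sum_(B in orbs D s x) #|B|)%N.
Proof.
move=> sD xD; have sub := perm_on_porbit sD xD.
rewrite -(cardsID (porbit s x) D) (setIidPr sub).
congr (_ + _)%N; rewrite -sum1_card (@sum_orbs nat D s x (fun=> 1%N) sD xD).
by apply: eq_bigr => B _; apply: natn.
Qed.

(* The series t_D(s) of the header, where the division by [sh2 1] is absorbed *)
(* by [shq] at the cycle of [x], so that no Laurent series is needed.         *)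
Definition star_ser D s x : pser :=
  pser_const ((#|D|)`!%:R^-1) *
  (sh2 1 ^+ #|D|.-1 * shq #|porbit s x| * \prod_(B in orbs D s x) sh2 #|B|).

(** The conditional term adds a point: if s x = a, then [tperm a x * s] fixes [a] and also lives on
    [D :\ a]. The factor 1/d! is dictated by this term, since the coefficient d that it has in the
    join-cut equation turns 1/d! into 1/(d-1)!. *)
Lemma star_ser_ode D s x : perm_on D s -> x \in D ->
  pser_deriv (star_ser D s x) =
  \sum_(a in D :\ x) (star_ser D (tperm a x * s) x +
    (if s x == a then star_ser (D :\ a) (tperm a x * s) x else 0)).
Proof.
move=> sD xD; have cardD := card_orbs sD xD.
set b := #|porbit s x| in cardD; have b_gt0 : (0 < b)%N by rewrite lt0n card_porbit_neq0.
case: b b_gt0 cardD (erefl b : #|porbit s x| = b) => // b _ cardD def_b.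
case defd: #|D| => [|[|e]]; first by rewrite defd addSn in cardD.
  have D1 : D = [set x].
    by apply/esym/eqP; rewrite eqEcard sub1set xD defd cards1.
  have orbs0 : orbs D s x = set0.
    apply/setP => B; rewrite in_orbs in_set0 D1 subset1.
    apply/negP => /and3P[/imsetP[y _ ->]] /orP[/eqP->|/eqP]; first by rewrite inE eqxx.
    by move/setP/(_ y); rewrite porbit_id inE.
  rewrite D1 setDv big_set0 -D1 /star_ser orbs0 big_set0 defd expr0 mul1r mulr1.
  have -> : #|porbit s x| = 1%N by move: cardD; rewrite def_b defd; lia.
  by rewrite shq1 mulr1 pser_deriv_const.
rewrite big_split /= -big_mkcondr /=.
rewrite /star_ser pser_derivZ def_b defd /=.
rewrite (@join_cut_ode _ _ _ b e); last by rewrite -defd.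
set Pi := \prod_(B in orbs D s x) sh2 #|B|.
pose c := pser_const (e.+2`!%:R^-1).
rewrite -/c mulrDr; congr (_ + _).
  have sub := perm_on_porbit sD xD.
  rewrite mulrDr [X in _ * X]addrC mulrDr.
  rewrite (bigID (fun a => a \in porbit s x)) /=; congr (_ + _).
    (* The points of the cycle other than [x] are s^(i+1) x. Cutting there splits off a cycle of
       length i + 1 and leaves b - i at [x], hence the reversal of the convolution. *)
    transitivity (\sum_(a in porbit s x | a != x)
        (c * (sh2 1 ^+ e.+1 * shq #|porbit (tperm a x * s) x| *
           (sh2 #|porbit (tperm a x * s) a| * Pi)))).
      rewrite big_mkcondr sum_porbit def_b big_ord_recl expg0 perm1 eqxx add0r.
      rewrite mulr_suml !mulr_sumr (reindex_inj rev_ord_inj) /=.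
      apply: eq_bigr => i _; rewrite /bump add1n.
      have lt_ib : (0 < i.+1 < #|porbit s x|)%N by rewrite def_b /= ltnS.
      have [-> ->] := card_porbit_cut lt_ib.
      rewrite def_b ifT; last first.
        apply/eqP => e1; have /= := @perm_pow_inj s x i.+1 0%N.
        by rewrite expg0 perm1 => /(_ _ _ e1); case/andP: lt_ib => _ ->; rewrite def_b => /(_ isT isT).
      have -> : ((b - (b - i.+1)) = i.+1)%N by have := ltn_ord i; lia.
      have -> : ((b - i.+1).+1 = b.+1 - i.+1)%N by have := ltn_ord i; lia.
      by ring.
    have eqset : (fun a => (a \in porbit s x) && (a != x)) =1
       (fun a => (a \in D :\ x) && (a \in porbit s x)).
      move=> a; rewrite !inE andbC -andbA; congr (_ && _).
      by have [ax|] := boolP (a \in porbit s x); rewrite ?(subsetP sub a ax) ?andbF.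
    rewrite (eq_bigl _ _ eqset); apply: eq_bigr => a /andP[]; rewrite !inE => /andP[ne_ax aD] a_x.
    have sub' : porbit (tperm a x * s) a \subset D.
      apply: subset_trans (subsetUl _ (porbit (tperm a x * s) x)) _.
      by rewrite porbitU_mul_tperm subUset sub perm_on_porbit.
    have [-> nin] := orbs_cut ne_ax a_x sub'.
    by rewrite big_setU1.
  pose G B := c * (sh2 1 ^+ e.+1 * shq (b.+1 + #|B|) *
     \prod_(B' in orbs D s x :\ B) sh2 #|B'|).
  transitivity (\sum_(B in orbs D s x) G B *+ #|B|).
    rewrite !mulr_sumr; apply: eq_bigr => B _; rewrite -mulr_natl /G; ring.
  rewrite -sum_orbs //; apply: eq_big => [a|a].
    rewrite !inE; have [ax|] := boolP (a \in porbit s x); rewrite ?andbF //= andbT.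
    by move=> na; case: eqP => // eax; rewrite eax porbit_id in na.
  rewrite inE => /andP[na aD].
  have ne_ax : a != x by apply: contraNneq na => ->; apply: porbit_id.
  by rewrite card_porbit_join // orbs_join // def_b.
(* The last term carries [shq b]. It vanishes with b when [x] is fixed; otherwise only a = s x
   contributes, and the cut at distance 1 splits off [a] as a fixed point. *)
have [sx|ne_sx] := eqVneq (s x) x.
  have -> : b = 0%N.
    apply/eqP; rewrite -eqSS -def_b -[1%N](cards1 x); apply/eqP.
    apply/eq_card => y; rewrite !inE; apply/porbitP/eqP => [[i ->]|->]; last by exists 0%N; rewrite perm1.
    by elim: i => [|i IHi]; rewrite ?perm1 // expgSr permM IHi.
  rewrite /shq big_ord0 mulr0 !mul0r !mulr0 big1 // => a /andP[].
  by rewrite sx !inE => /andP[/negP ne_ax _] /eqP e1; case: ne_ax; rewrite e1.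
pose a := s x; have a_x : a \in porbit s x by apply: (mem_porbit s 1).
have aD : a \in D by rewrite perm_closed.
rewrite (big_pred1 a) => [|y]; last first.
  by rewrite /a !inE [in RHS]eq_sym; case: (eqVneq (s x) y) => [<-|]; rewrite ?andbF // ne_sx aD.
have b_gt0 : (0 < b)%N.
  rewrite -ltnS -def_b; have : #|[set a; x]| = 2%N by rewrite cards2 ne_sx.
  move=> <-; apply/subset_leq_card/subsetP => y; rewrite !inE => /orP[]/eqP->//.
  exact: porbit_id.
have lt_1b : (0 < 1 < #|porbit s x|)%N by rewrite def_b.
have := card_porbit_cut lt_1b; rewrite expg1 -/a def_b => -[cara carx].
rewrite carx subn1 /=.
have cardDa : #|D :\ a| = e.+1.
  by apply/eqP; rewrite -eqSS -defd (cardsD1 a D) aD.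
have sub' : porbit (tperm a x * s) a \subset D.
  apply: subset_trans (subsetUl _ (porbit (tperm a x * s) x)) _.
  by rewrite porbitU_mul_tperm subUset !perm_on_porbit.
have -> : orbs (D :\ a) (tperm a x * s) x = orbs D s x.
  have [eqo nin] := orbs_cut ne_sx a_x sub'.
  apply/setP => B; have := congr1 (fun A : {set {set T}} => B \in A) eqo.
  rewrite in_setU1 !in_orbs subsetD1 => eqB.
  have [aB|naB] := boolP (a \in B); last first.
    rewrite andbT -/a eqB; case: eqP => //= eB.
    by rewrite eB porbit_id in naB.
  rewrite /= !andbF; apply/esym/negbTE/negP => /and3P[/imsetP[y _ eB] _ nx].
  case/negP: nx; rewrite eB in aB *; rewrite -!eq_porbit_mem in aB a_x *.
  by rewrite -(eqP aB) eq_sym.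
rewrite cardDa /= mulrA /c; congr (_ * _).
rewrite -(rmorph_nat pser_const) -rmorphM; congr pser_const.
rewrite factS natrM invfM mulrC mulrA mulfV ?mul1r //.
by rewrite pnatr_eq0.
Qed.

End JoinCut.

Lemma pser_coef0M (a b : pser) : (a * b) 0%N = a 0%N * b 0%N.
Proof. by rewrite pser_coefM big_ord1. Qed.

Lemma pser_coef0X (a : pser) n : (a ^+ n) 0%N = a 0%N ^+ n.
Proof. by elim: n => [|n IHn]; rewrite ?exprS // pser_coef0M IHn -exprS. Qed.

Lemma sh2_coef0 c : sh2 c 0%N = 0.
Proof. by rewrite /sh2 pser_coefB !pser_coef0X /exph /exphN /pser_expc !expr0 subrr. Qed.

Section CycleSeries.
Variable T : finType.
Implicit Types (s w : {perm T}) (a x y z : T) (D B : {set T}).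

(* [sh2 1] times t_D(s), which does not depend on a base point *)
Definition cycle_ser D s : pser :=
  pser_const ((#|D|)`!%:R^-1) * (sh2 1 ^+ #|D|.-1 *
    \prod_(B in [set B in porbits s | B \subset D]) sh2 #|B|).

Lemma cycle_ser_star D s x : perm_on D s -> x \in D ->
  cycle_ser D s = sh2 1 * star_ser D s x.
Proof.
move=> sD xD; rewrite /cycle_ser (_ : [set B in _ | _] = porbit s x |: orbs D s x).
  rewrite big_setU1 /= ?in_orbs ?porbit_id ?andbF // -(sh2_shq #|porbit s x|) /star_ser; ring.
apply/setP => B; rewrite in_setU1 in_orbs inE.
have [->|neB] /= := eqVneq B (porbit s x).
  by rewrite imset_f ?perm_on_porbit.
have [/imsetP[y _ defB]|//] := boolP (B \in porbits s).
suff -> : x \notin B by rewrite andbT.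
by apply: contra neB; rewrite defB -eq_porbit_mem eq_sym.
Qed.

(** The initial value of the differential equation, e^0 = 1: a positive power of [sh2 1] has no
    constant term, so only singletons survive. *)
Lemma star_ser_coef0 D s x : perm_on D s -> x \in D ->
  star_ser D s x 0%N = (D == [set x])%:R.
Proof.
move=> sD xD; have cardD := card_orbs sD xD.
have [D1|neD] := eqVneq D [set x]; last first.
  rewrite /star_ser !pser_coef0M pser_coef0X sh2_coef0 expr0n.
  suff -> : (#|D|.-1 == 0)%N = false by rewrite !mul0r mulr0.
  apply: contraNF neD => d0; rewrite eq_sym eqEcard sub1set xD cards1.
  by case: #|D| d0 => //= n /eqP ->.
have := cards1 x; rewrite -D1 cardD.
have := card_porbit_neq0 s x; case def_b: #|_| => [|b] // _ /eqP.
rewrite addSn eqSS addn_eq0 => /andP[/eqP b0 /eqP sum0].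
rewrite /star_ser def_b b0 shq1 mulr1 big1 => [|B BO].
  by rewrite D1 cards1 expr0 mul1r mulr1 /pser_const factS fact0 invr1.
have := BO; rewrite in_orbs => /and3P[/imsetP[y _ defB] _ _].
have : (#|B| <= 0)%N by rewrite -sum0 (bigD1 B BO) leq_addr.
by rewrite leqNgt lt0n defB card_porbit_neq0.
Qed.

End CycleSeries.

Section SquareMatrix.
Variables (K : comPzRingType) (m : nat).
Implicit Types A B : 'M[K]_m.
Lemma mx_scalerAr (c : K) A B : c *: (A * B) = A * (c *: B).
Proof. exact: scalemxAr. Qed.

Lemma mx_scalerAl (c : K) A B : c *: (A * B) = (c *: A) * B.
Proof. exact: scalemxAl. Qed.

Lemma mx_mul_sum I (s : seq I) (P : pred I) (F : I -> 'M[K]_m) A B :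
  A * (\sum_(i <- s | P i) F i) * B = \sum_(i <- s | P i) A * F i * B.
Proof. by rewrite mulr_sumr mulr_suml. Qed.

End SquareMatrix.

(** * Powers of Jucys-Murphy elements *)

Section StarPowers.
Variables (K : numFieldType) (n m : nat) (rho : 'S_n -> 'M[K]_m).
Hypothesis rhoM : forall g h, rho (g * h)%g = rho g * rho h.
Hypothesis rho1 : rho 1%g = 1.

Definition jm (x : 'I_n) := \sum_(a : 'I_n | (a < x)%N) rho (tperm a x).

Definition star_dom (x : 'I_n) (D : {set 'I_n}) :=
  (x \in D) && [forall a in D, (a <= x)%N].

Lemma perm_on_mul_tperm (D : {set 'I_n}) (a x : 'I_n) (w : 'S_n) : a \in D -> x \in D ->
  perm_on D (tperm a x * w)%g = perm_on D w.
Proof.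
move=> aD xD; wlog suff hw : w / perm_on D w -> perm_on D (tperm a x * w)%g.
  apply/idP/idP; last exact: hw.
  by move/hw; rewrite tperm_mulK.
move=> sD; apply: perm_onM => //; apply/subsetP => y.
by rewrite inE; case: tpermP => [->|->|]; rewrite ?eqxx.
Qed.

(** The product sends [a] to [w x], so it fixes [a] exactly when [w x] is [a]. *)
Lemma perm_on_mul_tperm1 (D : {set 'I_n}) (a x : 'I_n) (w : 'S_n) :
    a \in D -> x \in D -> a != x ->
  perm_on (D :\ a) (tperm a x * w)%g = perm_on D w && (w x == a).
Proof.
move=> aD xD ne_ax; apply/idP/andP => [sD|[sD /eqP wx]].
  have sD' : perm_on D (tperm a x * w)%g.
    by apply: subset_trans sD (subD1set _ _).
  split; first by rewrite -(perm_on_mul_tperm w aD xD).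
  have := out_perm sD (x := a); rewrite permM tpermL => -> //.
  by rewrite !inE eqxx.
have sD' : perm_on D (tperm a x * w)%g by rewrite perm_on_mul_tperm.
apply/subsetP => y /[dup] ny; rewrite inE => ny'; rewrite in_setD1 (subsetP sD') // andbT.
by apply: contraNneq ny' => ->; rewrite permM tpermL wx.
Qed.

(** For [a] in [D] the transposition permutes the terms of [D]. A term whose set misses [a] moves to
    the set enlarged by [a], where it becomes a permutation sending [x] to [a]; as a < x, the
    maximum of the set is unchanged. *)
Lemma jm_mul_star (x a : 'I_n) (g : {set 'I_n} -> 'S_n -> rat) : (a < x)%N ->
  rho (tperm a x) *
    (\sum_(D | star_dom x D) \sum_(w | perm_on D w) ratr (g D w) *: rho w) =
  \sum_(D | star_dom x D && (a \in D)) \sum_(w | perm_on D w)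
     ratr (g D (tperm a x * w)%g +
           (if w x == a then g (D :\ a) (tperm a x * w)%g else 0)) *: rho w.
Proof.
move=> lt_ax; have ne_ax : a != x by rewrite -val_eqE ltn_eqF.
pose t := tperm a x; have injt := mulgI t.
have tD D w : star_dom x D -> a \in D -> perm_on D (t * w)%g = perm_on D w.
  by case/andP=> xD _ aD; rewrite perm_on_mul_tperm.
rewrite mulr_sumr (bigID (fun D : {set 'I_n} => a \in D)) /=.
have push D (P : pred 'S_n) : rho t * (\sum_(w | P w) ratr (g D w) *: rho w) =
    \sum_(w | P (t * w)%g) ratr (g D (t * w)%g) *: rho w.
  rewrite mulr_sumr (reindex_inj injt) /=; apply: eq_bigr => w _.
  by rewrite -mx_scalerAr -rhoM /t tperm_mulK.
rewrite [X in X + _](eq_bigr (fun D => \sum_(w | perm_on D w)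
    ratr (g D (t * w)%g) *: rho w)); last first.
  move=> D /andP[domD aD]; rewrite push; apply: eq_bigl => w; exact: tD.
rewrite [X in _ + X](reindex_onto (fun D : {set 'I_n} => D :\ a)
   (fun D : {set 'I_n} => a |: D)) /=; last first.
  by move=> D /andP[_ naD]; rewrite setU1K.
rewrite [X in _ + X](eq_big (fun D => star_dom x D && (a \in D))
  (fun D => \sum_(w | perm_on D w && (w x == a)) ratr (g (D :\ a) (t * w)%g) *: rho w)).
- rewrite -big_split /=; apply: eq_bigr => D _; rewrite [X in _ + X]big_mkcondr -big_split /=.
  apply: eq_bigr => w _; rewrite raddfD /= scalerDl; case: ifP => // _.
  by rewrite raddf0 scale0r.
- move=> D; rewrite setD11 andbT; have [aD|naD] := boolP (a \in D); last first.
    rewrite andbF; apply/negP => /andP[_ /eqP e].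
    by rewrite -e setU11 in naD.
  rewrite andbT setD1K // eqxx andbT /star_dom in_setD1 eq_sym ne_ax /=.
  congr (_ && _); apply/forall_inP/forall_inP => h y; last first.
    by rewrite in_setD1 => /andP[_ /h].
  by have [-> _|ney yD] := eqVneq y a; [apply: ltnW | apply: h; rewrite in_setD1 ney].
move=> D /andP[/andP[domD _] /eqP e]; have aD : a \in D by rewrite -e setU11.
have xD : x \in D by case/andP: domD; rewrite in_setD1 => /andP[].
by rewrite push; apply: eq_bigl => w; rewrite perm_on_mul_tperm1.
Qed.

(** Read coefficientwise, the differential equation is an induction on [k]: one more factor J_x on
    the left, one derivative on the right. *)
Theorem jm_power (x : 'I_n) k :
  jm x ^+ k = \sum_(D | star_dom x D) \sum_(w | perm_on D w)
     ratr (k`!%:R * star_ser D w x k) *: rho w.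
Proof.
elim: k => [|k IHk].
  have dom1 : star_dom x [set x].
    by rewrite /star_dom set11; apply/forall_inP => a; rewrite inE => /eqP->.
  rewrite expr0 (bigD1 [set x]) //= [X in _ + X]big1 => [|D /andP[/andP[xD _] /negbTE neD]].
    rewrite (big_pred1 1%g) => [|w]; last first.
      apply/idP/eqP => [w1|->]; last exact: perm_on1.
      by apply: (perm_on_id w1); rewrite cards1.
    by rewrite star_ser_coef0 ?perm_on1 ?set11 // eqxx fact0 mulr1 rmorph1 scale1r addr0 rho1.
  by rewrite big1 // => w wD; rewrite star_ser_coef0 // neD mulr0 raddf0 scale0r.
rewrite exprS {1}/jm IHk mulr_suml.
transitivity (\sum_(a : 'I_n | (a < x)%N) \sum_(D | star_dom x D && (a \in D))
     \sum_(w | perm_on D w)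
     ratr (k`!%:R * (star_ser D (tperm a x * w)%g x k +
           (if w x == a then star_ser (D :\ a) (tperm a x * w)%g x else 0) k)) *: rho w).
  apply: eq_bigr => a lt_ax; rewrite jm_mul_star //; apply: eq_bigr => D _.
  apply: eq_bigr => w _; congr (ratr _ *: _); rewrite mulrDr; case: ifP => // _.
  by rewrite mulr0.
rewrite (exchange_big_dep (star_dom x)) /=; last by move=> a D _ /andP[].
apply: eq_bigr => D domD; rewrite exchange_big /=; apply: eq_bigr => w wD.
have [xD /forall_inP leD] := andP domD.
rewrite -scaler_suml -raddf_sum -mulr_sumr; congr (ratr _ *: _).
have -> : k.+1`!%:R * star_ser D w x k.+1 = k`!%:R * pser_deriv (star_ser D w x) k.
  by rewrite /pser_deriv factS natrM mulrA [_ * k`!%:R]mulrC.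
rewrite star_ser_ode // pser_coef_sum; congr (_ * _); apply: eq_big => [a|a _].
  rewrite domD in_setD1 ltn_neqAle val_eqE -!andbA.
  by have [aD|] := boolP (a \in D); rewrite ?andbF // leD ?andbT.
by rewrite pser_coefD.
Qed.

End StarPowers.

(** * Central elements from shifted powers of Jucys-Murphy elements *)

Section StarSums.
Variables (K : numFieldType) (n m : nat) (rho : 'S_n -> 'M[K]_m).
Hypothesis rhoM : forall g h, rho (g * h)%g = rho g * rho h.
Hypothesis rho1 : rho 1%g = 1.

Definition fact_coef (k : nat) (a : pser) : rat := k`!%:R * a k.

Lemma fact_coefM k (a b : pser) : fact_coef k (a * b) =
  \sum_(i < k.+1) 'C(k, i)%:R * (fact_coef i a * fact_coef (k - i) b).
Proof.
rewrite /fact_coef pser_coefM mulr_sumr; apply: eq_bigr => i _.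
by rewrite -(@bin_fact k i) -1?ltnS // !natrM; ring.
Qed.

Lemma fact_coef_expc k c : fact_coef k (pser_expc c) = c ^+ k.
Proof. by rewrite /fact_coef /pser_expc mulrC divfK // pnatr_eq0 -lt0n fact_gt0. Qed.

Lemma fact_coefB k a b : fact_coef k (a - b) = fact_coef k a - fact_coef k b.
Proof. by rewrite /fact_coef pser_coefB mulrBr. Qed.

(** The coefficient of z^k/k! in [sh2 1] times e^(x z). *)
Definition shift_diff (k : nat) (x : rat) : rat := (x + 2^-1) ^+ k - (x - 2^-1) ^+ k.

Lemma shift_diffE k x : shift_diff k x =
  \sum_(i < k.+1) 'C(k, i)%:R * fact_coef (k - i) (sh2 1) * x ^+ i.
Proof.
rewrite /shift_diff -!(fact_coef_expc k) !pser_expcD -fact_coefB -mulrBr.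
rewrite fact_coefM; apply: eq_bigr => i _.
by rewrite fact_coef_expc -mulrA; congr (_ * _); rewrite mulrC.
Qed.

(** The polynomial [shift_diff k] evaluated at the matrix J_x, through the expansion
    [shift_diffE]. *)
Definition jm_shift_diff k (x : 'I_n) : 'M[K]_m :=
  \sum_(i < k.+1) ratr ('C(k, i)%:R * fact_coef (k - i) (sh2 1)) *: jm rho x ^+ i.

Lemma jm_shift_diffE k x : jm_shift_diff k x =
  \sum_(D | star_dom x D) \sum_(w | perm_on D w)
     ratr (fact_coef k (cycle_ser D w)) *: rho w.
Proof.
rewrite /jm_shift_diff; under eq_bigr do rewrite jm_power // scaler_sumr.
rewrite exchange_big /=; apply: eq_bigr => D /andP[xD _].
under eq_bigr do rewrite scaler_sumr.
rewrite exchange_big /=; apply: eq_bigr => w wD.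
under eq_bigr do rewrite scalerA -rmorphM.
rewrite -scaler_suml -raddf_sum /=; congr (ratr _ *: _).
rewrite (cycle_ser_star wD xD) mulrC fact_coefM; apply: eq_bigr => i _.
by rewrite -mulrA; congr (_ * _); rewrite mulrC.
Qed.

Lemma sum_star_dom (V : nmodType) (F : {set 'I_n} -> V) :
  \sum_x \sum_(D | star_dom x D) F D = \sum_(D | D != set0) F D.
Proof.
rewrite (exchange_big_dep (fun D => D != set0)) /=; last first.
  by move=> x D _ /andP[xD _]; apply/set0Pn; exists x.
apply: eq_bigr => D /set0Pn[y yD].
have [x xD max_x] := arg_maxnP (fun i : 'I_n => i : nat) yD.
rewrite (big_pred1 x) // => z; apply/andP/eqP => [[zD /forall_inP le_z]|->].
  by apply/val_inj/eqP; rewrite eqn_leq (le_z x xD) andbT; apply: max_x.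
by split; [exact: xD | apply/forall_inP].
Qed.

Lemma sum_jm_shift_diff k : \sum_x jm_shift_diff k x =
  \sum_(D | D != set0) \sum_(w | perm_on D w) ratr (fact_coef k (cycle_ser D w)) *: rho w.
Proof. by rewrite -sum_star_dom; apply: eq_bigr => x _; rewrite jm_shift_diffE. Qed.

Lemma porbit_conj (w g : 'S_n) x : porbit (w ^ g)%g (g x) = g @: porbit w x.
Proof.
apply/setP => y; apply/porbitP/imsetP => [[i ->]|[z /porbitP[i ->] ->]]; last first.
  by exists i; rewrite -conjXg permJ.
by exists ((w ^+ i)%g x); rewrite ?mem_porbit // -conjXg permJ.
Qed.

Lemma cycle_serJ (D : {set 'I_n}) (w g : 'S_n) :
  cycle_ser (g @: D) (w ^ g)%g = cycle_ser D w.
Proof.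
have injg := @perm_inj _ g; have injS := imset_inj injg.
rewrite /cycle_ser card_imset //; congr (_ * (_ * _)).
rewrite (_ : [set B in _ | _] = (fun A : {set _} => g @: A) @: [set B in porbits w | B \subset D]).
  rewrite big_imset /=; last by move=> A B _ _; apply: injS.
  by apply: eq_bigr => B _; rewrite card_imset.
apply/setP => B; rewrite inE; apply/andP/imsetP => [[/imsetP[y _ ->]]|[A]].
  rewrite -[y](permKV g) porbit_conj => sub.
  exists (porbit w (g^-1%g y)) => //; rewrite inE imset_f //=.
  by apply/subsetP => z /(imset_f g)/(subsetP sub); rewrite mem_imset.
rewrite inE => /andP[/imsetP[y _ ->] sub] -> /=.
by rewrite -porbit_conj imset_f // porbit_conj imsetS.
Qed.

Lemma perm_onJ (D : {set 'I_n}) (w g : 'S_n) :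
  perm_on (g @: D) (w ^ g)%g = perm_on D w.
Proof.
apply/subsetP/subsetP => sD y; rewrite inE => ny.
  have := sD (g y); rewrite inE permJ (inj_eq perm_inj) => /(_ ny).
  by rewrite mem_imset //; apply: perm_inj.
rewrite -[y](permKV g) permJ (inj_eq perm_inj) in ny *.
by rewrite mem_imset; [apply: sD; rewrite inE | apply: perm_inj].
Qed.

(** After summation over [x] every nonempty [D] occurs once, with a coefficient that sees only the
    size of [D] and the cycle lengths; conjugation permutes the terms. *)
Lemma sum_jm_shift_diff_central k (g : 'S_n) :
  rho g * \sum_x jm_shift_diff k x = (\sum_x jm_shift_diff k x) * rho g.
Proof.
rewrite sum_jm_shift_diff mulr_sumr mulr_suml.
have injS : injective (fun D : {set 'I_n} => g @: D) by apply/imset_inj/perm_inj.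
rewrite (reindex_inj injS) /=; apply: eq_big => [D|D _].
  by rewrite -!card_gt0 card_imset //; apply: perm_inj.
rewrite mulr_sumr mulr_suml (reindex_inj (conjg_inj g)) /=.
apply: eq_big => [w|w _]; first exact: perm_onJ.
rewrite cycle_serJ -mx_scalerAr -mx_scalerAl -!rhoM.
by congr (_ *: rho _); rewrite conjgE !mulgA mulgV mul1g.
Qed.

End StarSums.

(** * Jucys-Murphy elements and Young symmetrizers *)

Section YoungSymmetrizer.
Variables (K : numFieldType) (n m : nat) (rho : 'S_n -> 'M[K]_m).
Hypothesis rhoM : forall g h, rho (g * h)%g = rho g * rho h.

Definition below (k : nat) : {set 'I_n} := [set x : 'I_n | (x < k)%N].

(** For [f] the row or the column function this is the row or column group of the tableau cut down
    to its first [k] entries. The truncation is what allows an argument along the chain of the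
    groups S_k. *)
Definition fiber_stab (f : 'I_n -> nat) (k : nat) : {set 'S_n} :=
  [set g | perm_on (below k) g & [forall x, f (g x) == f x]].

Lemma fiber_stabP f k g :
  reflect (perm_on (below k) g /\ forall x, f (g x) = f x) (g \in fiber_stab f k).
Proof.
rewrite inE; apply: (iffP andP) => -[-> h]; split=> //.
  by move=> x; apply/eqP/(forallP h).
by apply/forallP => x; apply/eqP.
Qed.

Lemma fiber_stab1 f k : 1%g \in fiber_stab f k.
Proof. by apply/fiber_stabP; split=> [|x]; rewrite ?perm_on1 ?perm1. Qed.

Lemma fiber_stabM f k g h : h \in fiber_stab f k ->
  ((h * g)%g \in fiber_stab f k) = (g \in fiber_stab f k).
Proof.
have mul u v : u \in fiber_stab f k -> v \in fiber_stab f k -> (u * v)%g \in fiber_stab f k.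
  move=> /fiber_stabP[uD uf] /fiber_stabP[vD vf].
  by apply/fiber_stabP; split=> [|x]; rewrite ?perm_onM // permM vf uf.
move=> hf; apply/idP/idP; last exact: mul.
move/(mul h^-1%g); rewrite mulKg; apply.
case/fiber_stabP: hf => hD hf; apply/fiber_stabP; split=> [|x]; rewrite ?perm_onV //.
by rewrite -[in RHS](permKV h x) hf.
Qed.

Lemma fiber_stabMr f k g h : h \in fiber_stab f k ->
  ((g * h)%g \in fiber_stab f k) = (g \in fiber_stab f k).
Proof.
move=> hf; apply/idP/idP => [gh|gf]; last by rewrite fiber_stabM.
have hV : (h^-1)%g \in fiber_stab f k.
  by rewrite -(fiber_stabM _ hf) mulgV fiber_stab1.
by rewrite -(fiber_stabM h^-1%g gh) mulgK in hV.
Qed.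

Lemma fiber_stabS f j k g : (j <= k)%N -> g \in fiber_stab f j -> g \in fiber_stab f k.
Proof.
move=> lejk /fiber_stabP[gD gf]; apply/fiber_stabP; split=> //.
apply: subset_trans gD _; apply/subsetP => x; rewrite !inE => /leq_trans; exact.
Qed.

(** [b] selects the trivial character (for rows) or the sign (for columns), so both symmetrizers are
    treated at once. *)
Definition sgnb (b : bool) (g : 'S_n) : K := (-1) ^+ (b && odd_perm g).

Lemma sgnbM b g h : sgnb b (g * h)%g = sgnb b g * sgnb b h.
Proof. by case: b; rewrite /sgnb /= ?mulr1 // odd_permM signr_addb. Qed.

Lemma sgnb_sqr b g : sgnb b g * sgnb b g = 1.
Proof. by rewrite /sgnb -expr2 sqrr_sign. Qed.

Definition stab_sum b f k : 'M[K]_m := \sum_(g in fiber_stab f k) sgnb b g *: rho g.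

Lemma stab_sum_mull b f k h : h \in fiber_stab f k ->
  rho h * stab_sum b f k = sgnb b h *: stab_sum b f k.
Proof.
move=> hf; rewrite mulr_sumr [in RHS]/stab_sum [in RHS](reindex_inj (mulgI h)) scaler_sumr /=.
apply: eq_big => [g|g _]; first by rewrite fiber_stabM.
by rewrite -mx_scalerAr -rhoM sgnbM scalerA mulrA sgnb_sqr mul1r.
Qed.

Lemma stab_sum_mulr b f k h : h \in fiber_stab f k ->
  stab_sum b f k * rho h = sgnb b h *: stab_sum b f k.
Proof.
move=> hf; rewrite mulr_suml [in RHS]/stab_sum [in RHS](reindex_inj (mulIg h)) scaler_sumr /=.
apply: eq_big => [g|g _]; first by rewrite fiber_stabMr.
by rewrite -mx_scalerAl -rhoM sgnbM mulrC scalerA mulrA sgnb_sqr mul1r.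
Qed.

Lemma stab_sum_mulS b f j k : (j <= k)%N ->
  stab_sum b f k * stab_sum b f j = #|fiber_stab f j|%:R *: stab_sum b f k.
Proof.
move=> lejk; rewrite [stab_sum b f j]/stab_sum mulr_sumr.
rewrite (eq_bigr (fun=> stab_sum b f k)) ?sumr_const ?scaler_nat // => h hf.
by rewrite -mx_scalerAr stab_sum_mulr ?(fiber_stabS lejk) // scalerA sgnb_sqr scale1r.
Qed.

Lemma stab_sum_mulSl b f j k : (j <= k)%N ->
  stab_sum b f j * stab_sum b f k = #|fiber_stab f j|%:R *: stab_sum b f k.
Proof.
move=> lejk; rewrite [stab_sum b f j]/stab_sum mulr_suml.
rewrite (eq_bigr (fun=> stab_sum b f k)) ?sumr_const ?scaler_nat // => h hf.
by rewrite -mx_scalerAl stab_sum_mull ?(fiber_stabS lejk) // scalerA sgnb_sqr scale1r.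
Qed.

Definition jm_sum (k : nat) : 'M[K]_m := \sum_(x : 'I_n | (x < k)%N) jm rho x.

(** Conjugation by [g] fixes [x] and permutes the points below it. *)
Lemma jm_comm_perm (x : 'I_n) g : perm_on (below x) g -> GRing.comm (rho g) (jm rho x).
Proof.
move=> gD; rewrite /GRing.comm /jm mulr_sumr mulr_suml.
rewrite (reindex_inj (@perm_inj _ g)) /=; apply: eq_big => [a|a _].
  by have := perm_closed a gD; rewrite !inE.
rewrite -!rhoM; congr rho.
have gx : g x = x by rewrite (out_perm gD) // inE ltnn.
by rewrite -[in tperm _ x]gx -tpermJ conjgE !mulgA mulgV mul1g.
Qed.

(** [jm_sum k] is the sum of all transpositions of S_k. Doubling it gives a sum over ordered pairs,
    whose invariance under conjugation is a mere reindexing. *)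
Lemma jm_sum_double k : jm_sum k + jm_sum k =
  \sum_(p : 'I_n * 'I_n | [&& (p.1 < k)%N, (p.2 < k)%N & p.1 != p.2]) rho (tperm p.1 p.2).
Proof.
have -> : jm_sum k =
    \sum_(p : 'I_n * 'I_n | (p.1 < p.2 < k)%N) rho (tperm p.1 p.2).
  rewrite /jm_sum /jm pair_big_dep /=.
  rewrite (reindex_inj (h := fun p : 'I_n * 'I_n => (p.2, p.1))) /=; last first.
    by move=> [a b] [c d] /= [-> ->].
  by apply: eq_bigl => p; rewrite andbC.
rewrite [X in _ + X](reindex_inj (h := fun p : 'I_n * 'I_n => (p.2, p.1))) /=; last first.
  by move=> [a b] [c d] /= [-> ->].
rewrite [RHS](bigID (fun p : 'I_n * 'I_n => (p.1 < p.2)%N)) /=; congr (_ + _).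
  by apply: eq_bigl => -[a b] /=; rewrite -val_eqE /=; lia.
apply: eq_big => [[a b]|[a b] _] /=; last by rewrite tpermC.
by rewrite -val_eqE /=; lia.
Qed.

Lemma jm_sum_comm_perm k g : perm_on (below k) g -> GRing.comm (rho g) (jm_sum k).
Proof.
move=> gD; suff : GRing.comm (rho g) (jm_sum k + jm_sum k).
  rewrite /GRing.comm mulrDr mulrDl => /eqP; rewrite -!mulr2n -!scaler_nat.
  by rewrite -subr_eq0 -scalerBr scaler_eq0 pnatr_eq0 /= subr_eq0 => /eqP.
rewrite jm_sum_double /GRing.comm mulr_sumr mulr_suml.
rewrite (reindex_inj (h := fun p : 'I_n * 'I_n => (g p.1, g p.2))) /=; last first.
  by move=> [a b] [c d] /= [/perm_inj-> /perm_inj->].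
apply: eq_big => [[a b]|[a b] _] /=.
  by have := (perm_closed a gD, perm_closed b gD); rewrite !inE (inj_eq perm_inj) => -[-> ->].
by rewrite -!rhoM -tpermJ conjgE !mulgA mulgV mul1g.
Qed.

Lemma comm_stab_sum X b f k : (forall g, perm_on (below k) g -> GRing.comm (rho g) X) ->
  GRing.comm (stab_sum b f k) X.
Proof.
move=> hX; apply/commr_sym/commr_sum => g /fiber_stabP[gD _].
by rewrite /GRing.comm -mx_scalerAl -mx_scalerAr hX.
Qed.

(* [r] and [c] give the rows and columns of a standard filling of a diagram  *)
(* in which the entries are read row by row.                                 *)
Variables (r c : 'I_n -> nat).
Hypothesis corner : forall u v, (r u < r v)%N ->
  exists s : 'I_n, [/\ (s < v)%N, r s = r u & c s = c v].
Hypothesis row_pos : forall x : 'I_n, #|[set a : 'I_n | (a < x)%N && (r a == r x)]| = c x.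
Hypothesis col_pos : forall x : 'I_n, #|[set a : 'I_n | (a < x)%N && (c a == c x)]| = r x.
Hypothesis rc_inj : forall u v, r u = r v -> c u = c v -> u = v.

Definition content (x : 'I_n) : K := (c x)%:R - (r x)%:R.

Local Notation A k := (stab_sum false r k).
Local Notation B k := (stab_sum true c k).

Lemma tperm_fiber_stab f k (u v : 'I_n) : (u < k)%N -> (v < k)%N -> f u = f v ->
  tperm u v \in fiber_stab f k.
Proof.
move=> uk vk fuv; apply/fiber_stabP; split.
  by apply/subsetP => z; rewrite !inE; case: tpermP => [->|->|]; rewrite ?eqxx.
by move=> x; case: tpermP => [->|->|].
Qed.

(* If [u] and [v] share neither row nor column, let [s] be the entry in the   *)
(* row of [u] and the column of [v]: then [(u s)(u v) = (u v)(v s)], where    *)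
(* [(u s)] is absorbed on the left and [(v s)], with a sign, on the right.    *)
Lemma young_tperm k (u v : 'I_n) : (u < k)%N -> (v < k)%N -> u != v ->
  A k * rho (tperm u v) * B k =
  ((r u == r v)%:R - (c u == c v)%:R) *: (A k * B k).
Proof.
move=> uk vk ne_uv.
have [ruv|ne_r] := eqVneq (r u) (r v).
  have [cuv|_] := eqVneq (c u) (c v); first by rewrite (rc_inj ruv cuv) eqxx in ne_uv.
  by rewrite stab_sum_mulr ?tperm_fiber_stab // /sgnb expr0 subr0 !scale1r.
have [cuv|ne_c] := eqVneq (c u) (c v).
  rewrite -mulrA stab_sum_mull ?tperm_fiber_stab // /sgnb odd_tperm ne_uv.
  by rewrite sub0r -mx_scalerAr expr1.
rewrite subrr scale0r.
wlog lt_r : u v uk vk ne_uv ne_r ne_c / (r u < r v)%N => [hw|].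
  have [lt_r|] := ltnP (r u) (r v); first exact: hw.
  by rewrite leq_eqVlt eq_sym (negbTE ne_r) tpermC; apply: hw; rewrite 1?eq_sym.
have [s [lt_sv rs cs]] := corner lt_r.
have lt_sk := ltn_trans lt_sv vk.
have ne_su : s != u by apply: contraNneq ne_c => <-; rewrite cs.
have ne_sv : s != v by rewrite -val_eqE ltn_eqF.
have hA : A k * rho (tperm u s) = A k.
  by rewrite stab_sum_mulr ?tperm_fiber_stab // /sgnb expr0 scale1r.
have hB : rho (tperm v s) * B k = - B k.
  by rewrite stab_sum_mull ?tperm_fiber_stab // /sgnb odd_tperm eq_sym ne_sv scaleN1r.
have swap : (tperm u s * tperm u v = tperm u v * tperm v s)%g.
  have -> : tperm v s = (tperm u s ^ tperm u v)%g by rewrite tpermJ tpermL tpermD // eq_sym.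
  by rewrite conjgE tpermV !mulgA tperm2 mul1g.
have e : A k * rho (tperm u v) * B k = - (A k * rho (tperm u v) * B k).
  rewrite -[in LHS]hA -(mulrA (A k)) -rhoM swap rhoM !mulrA -(mulrA _ _ (B k)) hB.
  by rewrite mulrN.
apply/eqP; have/eqP := e; rewrite -subr_eq0 opprK -mulr2n -scaler_nat.
by rewrite scaler_eq0 pnatr_eq0.
Qed.

(** Among the entries before [x], those in its row contribute +1 each and those in its column -1.
    There are [c x] and [r x] of them, which makes the content. *)
Lemma young_jm_sum k : (k <= n)%N ->
  A k * jm_sum k * B k = (\sum_(x : 'I_n | (x < k)%N) content x) *: (A k * B k).
Proof.
move=> le_kn; rewrite scaler_suml /jm_sum mx_mul_sum; apply: eq_bigr => x lt_xk.
rewrite /jm mx_mul_sum.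
rewrite (eq_bigr (fun a : 'I_n => ((r a == r x)%:R - (c a == c x)%:R) *: (A k * B k))).
  rewrite -scaler_suml; congr (_ *: _); rewrite sumrB /content; congr (_ - _).
    rewrite -(row_pos x) -sum1_card natr_sum [LHS]big_mkcond [RHS]big_mkcond.
    by apply: eq_bigr => a _; rewrite inE; case: (a < x)%N; case: eqP.
  rewrite -(col_pos x) -sum1_card natr_sum [LHS]big_mkcond [RHS]big_mkcond.
  by apply: eq_bigr => a _; rewrite inE; case: (a < x)%N; case: eqP.
move=> a lt_ax; apply: young_tperm => //; first exact: ltn_trans lt_xk.
by rewrite -val_eqE ltn_eqF.
Qed.

Lemma card_fiber_stab_neq0 f k : #|fiber_stab f k|%:R != 0 :> K.
Proof.
by rewrite pnatr_eq0 -lt0n card_gt0; apply/set0Pn; exists 1%g; apply: fiber_stab1.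
Qed.

(** The larger sums absorb the smaller ones up to the group orders, so whatever is known between
    [A j] and [B j] can be used between [A k] and [B k]. *)
Lemma young_absorb j k X : (j <= k)%N -> A k * X * B k =
  (#|fiber_stab r j|%:R * #|fiber_stab c j|%:R)^-1 *: (A k * (A j * X * B j) * B k).
Proof.
move=> lejk; set NA : K := _%:R; set NB : K := _%:R.
rewrite !mulrA stab_sum_mulS // -(mulrA _ (B j)) stab_sum_mulSl //.
rewrite -!(mx_scalerAl, mx_scalerAr) !scalerA -/NA -/NB.
have NA0 : NA != 0 := card_fiber_stab_neq0 r j.
have NB0 : NB != 0 := card_fiber_stab_neq0 c j.
by rewrite -[LHS]scale1r; congr (_ *: _); field; rewrite NA0 NB0.
Qed.

(* [J_x] is the difference of the sums of transpositions of S_(x+1) and of    *)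
(* S_x, which are central there and hence act on the two truncated Young      *)
(* symmetrizers by the sums of their contents.                                *)
Lemma young_jm_power_step (x : 'I_n) k :
  A x.+1 * jm rho x ^+ k * B x.+1 = content x ^+ k *: (A x.+1 * B x.+1).
Proof.
elim: k => [|k IHk]; first by rewrite !expr0 mulr1 scale1r.
have defT : jm_sum x.+1 = jm_sum x + jm rho x.
  rewrite /jm_sum (bigD1 x) //= addrC; congr (_ + _); apply: eq_bigl => y.
  by rewrite ltnS -val_eqE [RHS]ltn_neqAle andbC.
have jmx : jm rho x = jm_sum x.+1 - jm_sum x by rewrite defT addrAC subrr add0r.
have commA1 : GRing.comm (A x.+1) (jm_sum x.+1).
  by apply: comm_stab_sum => g; apply: jm_sum_comm_perm.
have commJ b f : GRing.comm (stab_sum b f x) (jm rho x).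
  by apply: comm_stab_sum => g; apply: jm_comm_perm.
have top : A x.+1 * jm_sum x.+1 * jm rho x ^+ k * B x.+1 =
    ((\sum_(y : 'I_n | (y < x.+1)%N) content y) * content x ^+ k) *: (A x.+1 * B x.+1).
  rewrite commA1 -!mulrA [X in _ * X]mulrA IHk -mx_scalerAr mulrA -commA1 young_jm_sum //.
  by rewrite scalerA mulrC.
(* J_x commutes with S_x, so its power can be moved past [B x]. Then [jm_sum x] stands directly
   between [A x] and [B x], where its eigenvalue is known. *)
have bot : A x.+1 * jm_sum x * jm rho x ^+ k * B x.+1 =
    ((\sum_(y : 'I_n | (y < x)%N) content y) * content x ^+ k) *: (A x.+1 * B x.+1).
  have commJk b f : GRing.comm (stab_sum b f x) (jm rho x ^+ k) by apply: commrX.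
  have absorb X := young_absorb X (leqnSn x).
  rewrite -(mulrA (A x.+1)) absorb.
  have -> : A x * (jm_sum x * jm rho x ^+ k) * B x =
      (\sum_(y : 'I_n | (y < x)%N) content y) *: (A x * jm rho x ^+ k * B x).
    rewrite mulrA -(mulrA (A x * jm_sum x)) -(commJk true c) mulrA young_jm_sum 1?ltnW //.
    by rewrite -mx_scalerAl -(mulrA (A x) (B x)) (commJk true c) mulrA.
  by rewrite -mx_scalerAr -mx_scalerAl scalerA [_^-1 * _]mulrC -[LHS]scalerA -absorb IHk scalerA.
rewrite exprS {1}jmx mulrBl mulrBr mulrBl !mulrA top bot -scalerBl -mulrBl.
congr (_ *: _); rewrite exprS; congr (_ * _).
rewrite (bigD1 x) //= (eq_bigl (fun y : 'I_n => (y < x)%N)) ?addrK // => y.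
by rewrite ltnS -val_eqE [RHS]ltn_neqAle andbC.
Qed.

Lemma young_jm_power (x : 'I_n) k :
  A n * jm rho x ^+ k * B n = content x ^+ k *: (A n * B n).
Proof.
have absorb X := young_absorb X (ltn_ord x).
rewrite absorb young_jm_power_step -mx_scalerAr -mx_scalerAl scalerA [_^-1 * _]mulrC -[LHS]scalerA.
by rewrite -[A x.+1]mulr1 -absorb mulr1.
Qed.

End YoungSymmetrizer.

(** * Irreducible representations of the symmetric group *)

(** E/c is idempotent, so its trace is its rank, which in characteristic zero vanishes only for E =
    0. *)
Lemma mx_quasi_idem_trace_eq0 (K : numFieldType) m (E : 'M[K]_m) c :
  c != 0 -> E *m E = c *: E -> \tr E = 0 -> E = 0.
Proof.
move=> c0 EE trE; have base := mulmx_base E.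
set L := col_base E in base; set U := row_base E in base.
(* In the full-rank factorization E = L U, the outer factors can be cancelled from L (U L) U = c L
   U. *)
have UL : U *m L = c%:M.
  have injL : injective (mulmx L : 'M_(\rank E) -> _).
    by move=> X Y; apply: (row_full_inj (col_base_full E)).
  have injU : injective (mulmx^~ U : 'M_(m, \rank E) -> _).
    by move=> X Y; apply: (row_free_inj (row_base_free E)).
  have EE' : (L *m U) *m (L *m U) = c *: (L *m U) by rewrite base.
  by apply/injL/injU; rewrite /= mul_mx_scalar -scalemxAl -EE' !mulmxA.
have : \tr (L *m U) = c *+ \rank E by rewrite mxtrace_mulC UL mxtrace_scalar.
rewrite base trE => /esym/eqP; rewrite -mulr_natr mulf_eq0 (negbTE c0) pnatr_eq0 /=.
by rewrite mxrank_eq0 => /eqP.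
Qed.

Section IrrSn.
Variable n : nat.
Local Notation G := [set: 'S_n]%G.
Variable i : Iirr G.
Local Notation rho := ('Chi_i : 'S_n -> _).

Lemma chi_rhoM g h : rho (g * h)%g = rho g * rho h.
Proof. by rewrite repr_mxM ?inE. Qed.

Lemma chi_rho1 : rho 1%g = 1.
Proof. by rewrite repr_mx1. Qed.

Lemma tr_chi_rho g : \tr (rho g) = 'chi_i g.
Proof. by rewrite -irrRepr cfunE inE mulr1n. Qed.

Lemma central_scalar Z : (forall g, rho g * Z = Z * rho g) ->
  exists2 z, Z = z%:M & \tr Z = z * 'chi_i 1%g.
Proof.
move=> cZ; have cent : centgmx 'Chi_i Z by apply/centgmxP => x _; apply/esym/cZ.
have /is_scalar_mxP[z ->] := mx_abs_irr_cent_scalar (groupC (socle_irr _)) cent.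
by exists z => //; rewrite mxtrace_scalar irr1_degree mulr_natr.
Qed.

(* The average of the conjugates of [A] is a nonzero scalar matrix. *)
Lemma trace_neq0_link A X : \tr A != 0 -> X != 0 -> exists g, A * rho g * X != 0.
Proof.
move=> trA X0; pose Z := \sum_(g : 'S_n) rho g^-1%g * A * rho g.
have cZ g : rho g * Z = Z * rho g.
  rewrite mulr_sumr mulr_suml (reindex_inj (mulIg g)) /=; apply: eq_bigr => h _.
  by rewrite !mulrA -chi_rhoM -[RHS]mulrA -chi_rhoM invMg mulKVg.
have [z defZ trZ] := central_scalar cZ.
have trZ' : \tr Z = #|G|%:R * \tr A.
  rewrite raddf_sum (eq_bigr (fun=> \tr A)) ?sumr_const ?cardsT ?mulr_natl // => g _.
  transitivity (\tr (rho g * (rho g^-1%g * A))); first exact: mxtrace_mulC.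
  by rewrite mulrA -chi_rhoM mulgV chi_rho1 mul1r.
have z0 : z != 0.
  apply: contra_neq trA => z0; apply/eqP; move/eqP: trZ'.
  by rewrite trZ z0 mul0r eq_sym mulf_eq0 (negbTE (neq0CG _)).
apply/existsP; apply: contraNT X0; rewrite negb_exists => /forallP h.
have : Z * X = 0.
  rewrite mulr_suml big1 // => g _; move: (h g); rewrite negbK => /eqP e.
  by rewrite -!mulrA (mulrA A) e mulr0.
by rewrite defZ -[_ * _]/(_ *m _) mul_scalar_mx => /eqP; rewrite scaler_eq0 (negbTE z0).
Qed.

Local Notation S b f := (stab_sum rho b f n).

(** Multiplicities of constituents are seen by traces, whereas the symmetrizer arguments need
    matrices. This passes from one to the other. *)
Lemma stab_sum_eq0_trace b f : \tr (S b f) = 0 -> S b f = 0.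
Proof.
apply: (@mx_quasi_idem_trace_eq0 _ _ _ #|fiber_stab f n|%:R).
  exact: card_fiber_stab_neq0.
exact: (stab_sum_mulS chi_rhoM).
Qed.

Lemma tr_stab_sum b f :
  \tr (S b f) = \sum_(g in fiber_stab f n) sgnb algC b g * 'chi_i g.
Proof. by rewrite raddf_sum; apply: eq_bigr => g _; rewrite /= mxtraceZ tr_chi_rho. Qed.

(* If two entries of a row of [r] were moved by [g] to the same column of    *)
(* [c], the transposition exchanging them would negate the product.          *)
Lemma stab_sum_link_inj (r c : 'I_n -> nat) g :
    S false r * rho g * S true c != 0 ->
  forall u v, r u = r v -> c (g u) = c (g v) -> u = v.
Proof.
move=> ne0 u v ruv cuv; apply/eqP/negPn/negP => ne_uv; case/negP: ne0.
have low (x : 'I_n) : (x < n)%N := ltn_ord x.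
have hA : S false r * rho (tperm u v) = S false r.
  by rewrite (stab_sum_mulr chi_rhoM) ?tperm_fiber_stab // /sgnb expr0 scale1r.
have hB : rho (tperm (g u) (g v)) * S true c = - S true c.
  rewrite (stab_sum_mull chi_rhoM) ?tperm_fiber_stab // /sgnb odd_tperm.
  by rewrite (inj_eq perm_inj) ne_uv scaleN1r.
have e : S false r * rho g * S true c = - (S false r * rho g * S true c).
  rewrite -[in LHS]hA -(mulrA (S false r)) -chi_rhoM.
  have -> : (tperm u v * g = g * tperm (g u) (g v))%g.
    by rewrite -tpermJ conjgE !mulgA mulgV mul1g.
  by rewrite chi_rhoM !mulrA -(mulrA _ _ (S true c)) hB mulrN.
by have/eqP := e; rewrite -subr_eq0 opprK -mulr2n -scaler_nat scaler_eq0 pnatr_eq0.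
Qed.

End IrrSn.

(** * Tableaux *)

Section InitialSegment.
Variables (T : finType) (A : {set T}) (f : T -> nat) (k : nat).
Hypotheses (injf : {in A &, injective f}) (ltf : forall a, a \in A -> (f a < k)%N).
Hypothesis surf : forall j, (j < k)%N -> exists2 a, a \in A & f a = j.

Lemma perm_initial_segment : perm_eq [seq f a | a <- enum A] (iota 0 k).
Proof.
apply: uniq_perm; rewrite ?iota_uniq ?map_inj_in_uniq ?enum_uniq //.
  by move=> a b; rewrite !mem_enum; apply: injf.
move=> j; rewrite mem_iota /= add0n; apply/mapP/idP => [[a]|/surf[a aA <-]].
  by rewrite mem_enum => /ltf ltfa ->.
by exists a; rewrite ?mem_enum.
Qed.

Lemma card_initial_segment : #|A| = k.
Proof.
rewrite cardE -(size_map f) -[RHS](size_iota 0).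
exact: perm_size perm_initial_segment.
Qed.

Lemma sum_initial_segment (V : nmodType) (F : nat -> V) :
  \sum_(a in A) F (f a) = \sum_(j < k) F j.
Proof.
rewrite -big_enum -(big_map f predT F) (perm_big _ perm_initial_segment) /=.
by rewrite -[X in iota _ X]subn0 -/(index_iota 0 _) big_mkord.
Qed.

End InitialSegment.

Lemma card_set_sum (T : finType) (P : pred T) : #|[set a | P a]| = (\sum_a P a)%N.
Proof.
by rewrite -sum1_card big_mkcond; apply: eq_bigr => a _; rewrite inE; case: (P a).
Qed.

(** In a decreasing sequence the entries above [j] come first. In terms of diagrams, transposition
    exchanges the two coordinates of a cell. *)
Lemma count_gt_sorted (s : seq nat) i j : sorted geq s ->
  (i < count (fun p => (j < p)%N) s)%N = (j < nth 0%N s i)%N.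
Proof.
elim: s i => [|p s IHs] i; first by rewrite nth_nil !ltn0.
move=> /= p_s; have sorted_s := path_sorted p_s.
have [lt_jp|le_pj] := ltnP j p; first by case: i => //= i; rewrite add1n ltnS IHs.
have all_le : all (fun q => (q <= p)%N) s.
  by apply: order_path_min p_s => a b c /= ab bc; apply: leq_trans bc ab.
have -> : count (fun q => (j < q)%N) s = 0%N.
  apply/eqP; rewrite -leqn0 leqNgt -has_count -all_predC.
  by apply: sub_all all_le => q /=; rewrite -leqNgt => /leq_trans; apply.
rewrite addn0 ltn0; apply/esym/negbTE; rewrite -leqNgt.
case: i => [|i] //=; have [lt_i|ge_i] := ltnP i (size s).
  by apply: leq_trans le_pj; apply: (allP all_le); apply: mem_nth.
by rewrite nth_default.
Qed.

Section Tableau.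
Variables (s : seq nat) (n : nat).
Hypothesis sum_s : sumn s = n.
Hypothesis sort_s : sorted geq s.

(** The same [reshape_index] as in [young_set], so the row group of the tableau is the Young
    subgroup itself. *)
Definition tab_row (x : 'I_n) := reshape_index s x.
Definition tab_col (x : 'I_n) := reshape_offset s x.
Local Notation r := tab_row.
Local Notation c := tab_col.

Lemma tab_colP x : (c x < nth 0%N s (r x))%N.
Proof. by apply: reshape_offsetP; rewrite sum_s. Qed.

Lemma tab_cell i j : (j < nth 0%N s i)%N -> exists2 x, r x = i & c x = j.
Proof.
move=> lt_j; have lt_x : (flatten_index s i j < n)%N by rewrite -sum_s flatten_indexP.
by exists (Ordinal lt_x); rewrite /tab_row /tab_col /= ?flatten_indexKl ?flatten_indexKr.
Qed.

Lemma tab_inj u v : r u = r v -> c u = c v -> u = v.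
Proof.
move=> ruv cuv; apply: val_inj; rewrite /= -(reshape_indexK s u) -(reshape_indexK s v).
by congr flatten_index.
Qed.

Lemma tab_leq (u v : 'I_n) : (u <= v)%N = (r u < r v)%N || ((r u == r v) && (c u <= c v)%N).
Proof. exact: reshape_leq. Qed.

Lemma tab_ltn (u v : 'I_n) : (u < v)%N = (r u < r v)%N || ((r u == r v) && (c u < c v)%N).
Proof. by rewrite ltnNge tab_leq; have := @tab_inj u v; clear sum_s sort_s; lia. Qed.

Lemma nth_sorted_geq i j : (i <= j)%N -> (nth 0 s j <= nth 0 s i)%N.
Proof.
move=> le_ij; have [lt_j|ge_j] := ltnP j (size s); last by rewrite nth_default.
have tr : transitive geq by move=> a b d /= ab da; apply: leq_trans da ab.
by apply: (sorted_leq_nth tr leqnn); rewrite ?inE ?(leq_ltn_trans le_ij).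
Qed.

Lemma tab_corner (u v : 'I_n) : (r u < r v)%N ->
  exists x : 'I_n, [/\ (x < v)%N, r x = r u & c x = c v].
Proof.
move=> lt_r; have [|x rx cx] := @tab_cell (r u) (c v).
  by apply: leq_trans (tab_colP v) _; apply/nth_sorted_geq/ltnW.
by exists x; split=> //; rewrite tab_ltn rx lt_r.
Qed.

Lemma tab_row_pos (x : 'I_n) : #|[set a : 'I_n | (a < x)%N && (r a == r x)]| = c x.
Proof.
apply: (card_initial_segment (f := c)) => [u v|a|j lt_j].
- by rewrite !inE => /andP[_ /eqP ru] /andP[_ /eqP rv]; apply: tab_inj; rewrite ru.
- by rewrite inE tab_ltn => /andP[+ /eqP ra]; rewrite ra ltnn eqxx.
have [|a ra ca] := @tab_cell (r x) j; first exact: ltn_trans (tab_colP x).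
by exists a; rewrite // inE tab_ltn ra ca ltnn !eqxx lt_j.
Qed.

Lemma tab_col_pos (x : 'I_n) : #|[set a : 'I_n | (a < x)%N && (c a == c x)]| = r x.
Proof.
apply: (card_initial_segment (f := r)) => [u v|a|i lt_i].
- by rewrite !inE => /andP[_ /eqP cu] /andP[_ /eqP cv] ruv; apply: tab_inj; rewrite ?cu.
- by rewrite inE tab_ltn => /andP[+ /eqP ca]; rewrite ca ltnn andbF orbF.
have [|a ra ca] := @tab_cell i (c x).
  by apply: leq_trans (tab_colP x) _; apply/nth_sorted_geq/ltnW.
by exists a; rewrite // inE tab_ltn ra ca lt_i eqxx.
Qed.

Lemma sum_tab_row (V : nmodType) i (F : nat -> V) :
  \sum_(x | r x == i) F (c x) = \sum_(j < nth 0%N s i) F j.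
Proof.
rewrite -(@sum_initial_segment _ [set x | r x == i] c) => [|u v|a|j /tab_cell[a ra ca]].
- by apply: eq_bigl => x; rewrite inE.
- by rewrite !inE => /eqP ru /eqP rv; apply: tab_inj; rewrite ru.
- by rewrite inE => /eqP <-; apply: tab_colP.
by exists a; rewrite // inE ra.
Qed.

Lemma card_tab_row i : #|[set a | r a == i]| = nth 0%N s i.
Proof.
apply: (card_initial_segment (f := c)) => [u v|a|j /tab_cell[a ra ca]].
- by rewrite !inE => /eqP ru /eqP rv; apply: tab_inj; rewrite ru.
- by rewrite inE => /eqP <-; apply: tab_colP.
by exists a; rewrite // inE ra.
Qed.

Lemma card_tab_col j : #|[set a | c a == j]| = count (fun p => (j < p)%N) s.
Proof.
apply: (card_initial_segment (f := r)) => [u v|a|i].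
- by rewrite !inE => /eqP cu /eqP cv ruv; apply: tab_inj; rewrite ?cu.
- by rewrite inE count_gt_sorted // => /eqP <-; apply: tab_colP.
rewrite count_gt_sorted // => /tab_cell[a ra ca].
by exists a; rewrite // inE ca.
Qed.

(* For a filling [k] that is injective on the rows, [rank x <= k x], and the  *)
(* sum of the ranks counts the pairs of entries in a common row, as does the  *)
(* sum of the columns.                                                        *)
Section Fillings.
Variable k : 'I_n -> nat.
Hypothesis rk_inj : forall u v, r u = r v -> k u = k v -> u = v.

Let rank x := #|[set a | (k a < k x)%N && (r a == r x)]|.

Lemma rank_le x : (rank x <= k x)%N.
Proof.
rewrite /rank -[leqRHS]card_ord -(@card_in_imset _ _ (fun a => inord (k a) : 'I_(k x).+1)).
  apply: leq_trans (_ : #|[set j : 'I_(k x).+1 | (j < k x)%N]| <= _)%N.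
    apply/subset_leq_card/subsetP => _ /imsetP[a + ->].
    by rewrite !inE => /andP[lt_a _]; rewrite inordK // ltnS ltnW.
  rewrite (@card_initial_segment _ _ val (k x)) ?card_ord //.
  - by move=> u v _ _; apply: val_inj.
  - by move=> a; rewrite inE.
  by move=> j lt_j; exists (inord j); rewrite ?inE /= inordK // ltnS ltnW.
move=> u v; rewrite !inE => /andP[lt_u /eqP ru] /andP[lt_v /eqP rv] /(congr1 val) /=.
by rewrite !inordK ?ltnS ?(ltnW lt_u) ?(ltnW lt_v) //; apply: rk_inj; rewrite ru.
Qed.

Lemma pairs_in_rows (f : 'I_n -> nat) : (forall u v, r u = r v -> f u = f v -> u = v) ->
  ((\sum_x #|[set a | (f a < f x)%N && (r a == r x)]|).*2 =
   \sum_x #|[set a | (a != x) && (r a == r x)]|)%N.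
Proof.
move=> injf.
have e : (\sum_x #|[set a | (f a < f x)%N && (r a == r x)]| =
          \sum_x #|[set a | (f x < f a)%N && (r a == r x)]|)%N.
  rewrite (eq_bigr _ (fun x _ => card_set_sum _)).
  rewrite [RHS](eq_bigr _ (fun x _ => card_set_sum _)) exchange_big.
  by apply: eq_bigr => x _; apply: eq_bigr => a _; rewrite [r x == _]eq_sym.
rewrite -addnn {2}e -big_split; apply: eq_bigr => x _.
rewrite /= -cardsUI (_ : _ :&: _ = set0) ?cards0 ?addn0.
  apply: eq_card => a; rewrite !inE -andb_orl -neq_ltn.
  have [ra|] := eqVneq (r a) (r x); rewrite ?andbF // !andbT.
  by congr (~~ _); apply/eqP/eqP => [/(injf _ _ ra)|->].
by apply/setP => a; rewrite !inE; case: ltngtP; rewrite ?andbF.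
Qed.

Lemma sum_tab_col_rank : (\sum_x c x = \sum_x rank x)%N.
Proof.
apply: double_inj; rewrite [RHS](pairs_in_rows rk_inj).
rewrite -(@pairs_in_rows val) => [|u v _ /val_inj //].
by congr (_.*2); apply: eq_bigr => x _; rewrite -tab_row_pos.
Qed.

Lemma sum_tab_col_le : (\sum_x c x <= \sum_x k x)%N.
Proof. by rewrite sum_tab_col_rank; apply: leq_sum => x _; apply: rank_le. Qed.

(** The ranks bound [k] from below and have the same total as the columns, so [k] equals the rank
    everywhere. Each row is thus filled with 0, 1, ..., and a row permutation carries the column
    function to [k]. *)
Lemma tab_factor : (\sum_x k x <= \sum_x c x)%N ->
  exists q : 'S_n, forall x, r (q x) = r x /\ c (q x) = k x.
Proof.
move=> le_k; have rank_leif x : (true -> rank x <= k x ?= iff (rank x == k x))%N.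
  by move=> _; apply/leqifP; have := rank_le x; rewrite leq_eqVlt; case: eqP.
have eq_rank x : rank x = k x.
  have [_] := leqif_sum rank_leif; rewrite -sum_tab_col_rank.
  rewrite eqn_leq le_k sum_tab_col_le => /esym/forallP/(_ x)/eqP //.
have lt_k x : (k x < nth 0%N s (r x))%N.
  rewrite -card_tab_row -(eq_rank x) /rank; apply/proper_card/properP; split.
    by apply/subsetP => a; rewrite !inE => /andP[].
  by exists x; rewrite !inE ?ltnn.
pose P x y := (r y == r x) && (c y == k x).
have exq x : exists y, P x y.
  by have [y ry cy] := tab_cell (lt_k x); exists y; rewrite /P ry cy !eqxx.
pose q x := xchoose (exq x).
have qP x : r (q x) = r x /\ c (q x) = k x.
  by have /andP[/eqP -> /eqP ->] := xchooseP (exq x).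
have injq : injective q.
  move=> u v quv; have [[ru cu] [rv cv]] := (qP u, qP v).
  by apply: rk_inj; rewrite -?ru -?cu quv.
by exists (perm injq) => x; rewrite permE.
Qed.

End Fillings.
End Tableau.

Lemma perm_of_fibers n (f g : 'I_n -> nat) :
    (forall j, #|[set a | f a == j]| = #|[set a | g a == j]|) ->
  exists p : 'S_n, forall x, g x = f (p x).
Proof.
move=> eq_fib; have : perm_eq [tuple g x | x < n] [tuple f x | x < n].
  have count_fib h j : count_mem j [tuple h x | x < n] = #|[set a | h a == j]|.
    rewrite count_map -sum1_count big_enum_cond -sum1_card.
    by apply: eq_bigl => a; rewrite inE.
  by rewrite /perm_eq; apply/allP => j _; rewrite /= !count_fib eq_fib.
case/tuple_permP => p e; exists p => x.
have := congr1 (fun t => nth 0%N t x) e.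
by rewrite -[LHS](tnth_nth 0%N) -(tnth_nth 0%N) !tnth_mktuple.
Qed.

Lemma sumn_fibers n (f : 'I_n -> nat) h : (forall x, (f x < h)%N) ->
  (\sum_(j < h) #|[set x | f x == j]|)%N = n.
Proof.
move=> lt_f; rewrite (eq_bigr _ (fun x _ => card_set_sum _)) exchange_big /=.
rewrite (eq_bigr (fun=> 1%N)) ?sum1_card ?card_ord // => x _.
rewrite (bigD1 (Ordinal (lt_f x))) //= eqxx big1 // => j ne_j.
by case: eqP => // e; case/eqP: ne_j; apply: val_inj; rewrite /= -e.
Qed.

Lemma sumn_conj_parts (s : seq nat) : sorted geq s -> sumn (conj_parts s) = sumn s.
Proof.
move=> sort_s; set n := sumn s; have sum_s : sumn s = n by [].
rewrite /conj_parts sumnE big_map -(@sumn_fibers n (@tab_col s n) (head 0%N s)).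
  rewrite -[X in iota _ X]subn0 -/(index_iota 0 _) big_mkord.
  by apply: eq_bigr => j _; rewrite (card_tab_col sum_s).
move=> x; apply: leq_trans (tab_colP sum_s x) _; rewrite -nth0.
exact: nth_sorted_geq.
Qed.

Lemma nth_conj_parts (s : seq nat) j : sorted geq s ->
  nth 0%N (conj_parts s) j = count (fun p => (j < p)%N) s.
Proof.
move=> sort_s; rewrite /conj_parts; have [lt_j|ge_j] := ltnP j (head 0%N s).
  by rewrite (nth_map 0%N) ?size_iota ?nth_iota.
rewrite nth_default ?size_map ?size_iota //; apply/esym/eqP.
by rewrite -leqn0 leqNgt count_gt_sorted // nth0 -leqNgt.
Qed.

Lemma intpart_sorted (la : intpart) : sorted geq la.
Proof. by case/andP: (partsP la). Qed.

Lemma intpart_eq_counts (la nu : intpart) :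
  (forall j, count (fun p => (j < p)%N) la = count (fun p => (j < p)%N) nu) -> la = nu.
Proof.
move=> eq_c; apply: val_inj; apply: (@sorted_eq _ geq).
- by move=> a b c /= ab bc; apply: leq_trans bc ab.
- by move=> a b ba; apply/eqP; rewrite eqn_leq andbC.
- exact: intpart_sorted.
- exact: intpart_sorted.
have no0 (mu : intpart) : count_mem 0%N mu = 0%N.
  by apply/count_memPn; case/andP: (partsP mu).
have cnt (mu : intpart) j : (count_mem j.+1 mu =
    count (fun p => (j < p)%N) mu - count (fun p => (j.+1 < p)%N) mu)%N.
  suff -> : (count (fun p => (j < p)%N) mu =
    count_mem j.+1 mu + count (fun p => (j.+1 < p)%N) mu)%N by rewrite addnK.
  by elim: (parts mu) => //= p s ->; lia.
rewrite /perm_eq; apply/allP => -[|j] _ /=; first by rewrite !no0.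
by rewrite !cnt !eq_c.
Qed.

(** * The characters chi^lambda *)

Section Shape.
Variable n : nat.
Local Notation G := [set: 'S_n]%G.
Implicit Types (la nu : intpart) (i : Iirr G).

Local Notation A i la := (stab_sum ('Chi_i : 'S_n -> _) false (@tab_row la n) n).
Local Notation B i la := (stab_sum ('Chi_i : 'S_n -> _) true (@tab_col la n) n).

(* By Frobenius reciprocity, [i] occurs in the permutation module of the rows *)
(* and in the signed permutation module of the columns.                       *)
Definition row_col_constt (i : Iirr G) la :=
  (\tr (A i la) != 0) && (\tr (B i la) != 0).

Lemma fiber_stab_full (f : 'I_n -> nat) (g : 'S_n) :
  (g \in fiber_stab f n) = [forall x, f (g x) == f x].
Proof.
rewrite inE; suff -> : perm_on (below n n) g by [].
by apply/subsetP => x _; rewrite inE ltn_ord.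
Qed.

Lemma tr_row_col i la : \tr (A i la * B i la) =
  \sum_(p in fiber_stab (@tab_row la n) n) \sum_(q in fiber_stab (@tab_col la n) n)
    (-1) ^+ odd_perm q * 'chi_i (p * q)%g :> algC.
Proof.
rewrite /stab_sum big_distrlr raddf_sum; apply: eq_bigr => p _.
rewrite raddf_sum; apply: eq_bigr => q _ /=.
by rewrite -mx_scalerAl -mx_scalerAr -chi_rhoM !mxtraceZ tr_chi_rho /sgnb expr0 mul1r.
Qed.

(* The regular character extracts the coefficient of the identity in the      *)
(* Young symmetrizer, which is 1.                                             *)
Lemma ex_row_col_constt la : psize la = n -> exists i, row_col_constt i la.
Proof.
move=> sz; apply/existsP; apply: contraT; rewrite negb_exists => /forallP h.
have z (i : Iirr G) : 'chi_i 1%g * \tr (A i la * B i la) = 0 :> algC.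
  have := h i; rewrite /row_col_constt negb_and !negbK.
  by case/orP => /eqP/stab_sum_eq0_trace ->; rewrite ?mul0r ?mulr0 raddf0 mulr0.
have : \sum_(i : Iirr G) 'chi_i 1%g * \tr (A i la * B i la) = 0 :> algC by rewrite big1.
under eq_bigr => i _ do rewrite tr_row_col mulr_sumr.
under eq_bigr => i _ do under eq_bigr => p _ do rewrite mulr_sumr.
under eq_bigr => i _ do under eq_bigr => p _ do under eq_bigr => q _ do rewrite mulrCA.
rewrite exchange_big /=; under eq_bigr => p _ do rewrite exchange_big /=.
rewrite (bigD1 1%g) ?fiber_stab1 //= (bigD1 1%g) ?fiber_stab1 //=.
have reg p q : \sum_(i : Iirr G) (-1) ^+ odd_perm q * ('chi_i 1%g * 'chi_i (p * q)%g) =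
    (-1) ^+ odd_perm q * (#|G|%:R *+ ((p * q)%g == 1%g)) :> algC.
  rewrite -mulr_sumr -cfRegE cfReg_sum sum_cfunE; congr (_ * _).
  by apply: eq_bigr => i _; rewrite cfunE.
rewrite reg mul1g eqxx odd_perm1 mul1r mulr1n.
rewrite [X in _ + X + _]big1 ?addr0 => [|q /andP[_ q1]]; last first.
  by rewrite reg mul1g (negbTE q1) mulr0.
rewrite [X in _ + X]big1 ?addr0 => [/eqP|p /andP[pR p1]].
  by rewrite (negbTE (neq0CG _)).
rewrite big1 // => q qC; rewrite reg; case: eqP => [pq|]; last by rewrite mulr0.
(* If p q = 1, then p preserves both rows and columns and therefore fixes every cell. *)
case/negP: p1; apply/eqP/permP => x; rewrite perm1.
have pV : q = p^-1%g by rewrite -[q](mulKg p) pq mulg1.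
move: pR qC; rewrite !fiber_stab_full => /forallP/(_ x)/eqP pR /forallP/(_ (p x))/eqP.
by rewrite pV permK => /esym cC; apply: tab_inj pR cC.
Qed.

Lemma row_col_constt_link i la nu :
  row_col_constt i la -> row_col_constt i nu ->
  exists g, A i la * 'Chi_i g * B i nu != 0.
Proof.
case/andP=> trA _ /andP[_ trB]; apply: trace_neq0_link => //.
by apply: contraNneq trB => ->; rewrite raddf0.
Qed.

(** The columns of [nu], transported by the linking permutation, fill the diagram of [la]
    injectively on rows. *)
Lemma sum_tab_col_constt i la nu : psize la = n -> psize nu = n ->
  row_col_constt i la -> row_col_constt i nu ->
  (\sum_x @tab_col la n x <= \sum_x @tab_col nu n x)%N.
Proof.
move=> szla sznu cla cnu; have [g ne0] := row_col_constt_link cla cnu.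
have := sum_tab_col_le szla (stab_sum_link_inj ne0).
by move/leq_trans; apply; rewrite [leqRHS](reindex_inj (@perm_inj _ g)).
Qed.

(** By symmetry the totals of the column numbers agree. The column functions then differ by
    permutations of the entries, and column lengths determine a partition. *)
Lemma row_col_constt_inj i la nu : psize la = n -> psize nu = n ->
  row_col_constt i la -> row_col_constt i nu -> la = nu.
Proof.
move=> szla sznu cla cnu; have [g ne0] := row_col_constt_link cla cnu.
have [|q qP] := tab_factor szla (stab_sum_link_inj ne0).
  apply: leq_trans (sum_tab_col_constt sznu szla cnu cla).
  by rewrite [leqRHS](reindex_inj (@perm_inj _ g)).
apply: intpart_eq_counts => j.
rewrite -(card_tab_col szla (intpart_sorted la)) -(card_tab_col sznu (intpart_sorted nu)).
rewrite !card_set_sum (reindex_inj (@perm_inj _ q)) [RHS](reindex_inj (@perm_inj _ g)) /=.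
by apply: eq_bigr => x _; rewrite (qP x).2.
Qed.

(** A linking permutation g with A g B nonzero factors as a row permutation times a column
    permutation. Both are absorbed, so A g B is A B up to sign. *)
Lemma young_symmetrizer_neq0 i la : psize la = n -> row_col_constt i la ->
  A i la * B i la != 0.
Proof.
move=> sz cla; have [g ne0] := row_col_constt_link cla cla.
have [|q qP] := tab_factor sz (stab_sum_link_inj ne0).
  by rewrite [leqRHS](reindex_inj (@perm_inj _ g)).
apply: contraNneq ne0 => AB0.
have qR : q \in fiber_stab (@tab_row la n) n.
  by rewrite fiber_stab_full; apply/forallP => x; rewrite (qP x).1.
have hC : (q^-1 * g)%g \in fiber_stab (@tab_col la n) n.
  rewrite fiber_stab_full; apply/forallP => x.
  by rewrite permM -(qP _).2 permKV.
rewrite -[g](mulKVg q) chi_rhoM mulrA (stab_sum_mulr (@chi_rhoM n i)) // -mx_scalerAl -mx_scalerAl.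
rewrite -mulrA (stab_sum_mull (@chi_rhoM n i)) // -mx_scalerAr AB0 !scaler0 //.
Qed.

(** The central matrix [Z] is a scalar by Schur. Its trace is the character sum, and its value is
    found between A and B, whose product is nonzero. *)
Lemma cycle_ser_eigenvalue i la k : psize la = n -> row_col_constt i la ->
  \sum_(D : {set 'I_n} | D != set0) \sum_(w | perm_on D w)
     ratr (fact_coef k (cycle_ser D w)) * 'chi_i w =
  'chi_i 1%g * ratr (\sum_(x : 'I_n)
     shift_diff k ((tab_col la x)%:R - (tab_row la x)%:R)) :> algC.
Proof.
move=> sz cla; pose rho : 'S_n -> _ := 'Chi_i.
pose Z := \sum_x jm_shift_diff rho k x.
have [z defZ trZ] : exists2 z, Z = z%:M & \tr Z = z * 'chi_i 1%g.
  by apply: central_scalar => g; apply: sum_jm_shift_diff_central (@chi_rhoM n i) (@chi_rho1 n i) _ _.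
have -> : \sum_(D | D != set0) \sum_(w | perm_on D w)
     ratr (fact_coef k (cycle_ser D w)) * 'chi_i w = \tr Z :> algC.
  rewrite /Z (sum_jm_shift_diff (@chi_rhoM n i) (@chi_rho1 n i)) raddf_sum.
  apply: eq_bigr => D _; rewrite raddf_sum; apply: eq_bigr => w _.
  by rewrite /= mxtraceZ tr_chi_rho.
rewrite trZ mulrC; congr (_ * _).
have : A i la * Z * B i la = z *: (A i la * B i la).
  by rewrite defZ -[X in X * _]/(_ *m _) mul_mx_scalar -mx_scalerAl.
have -> : A i la * Z * B i la = ratr (\sum_(x : 'I_n)
     shift_diff k ((tab_col la x)%:R - (tab_row la x)%:R)) *: (A i la * B i la).
  rewrite /Z mx_mul_sum raddf_sum scaler_suml; apply: eq_bigr => x _.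
  rewrite /jm_shift_diff mx_mul_sum shift_diffE raddf_sum scaler_suml.
  apply: eq_bigr => j _; rewrite -mx_scalerAr -mx_scalerAl.
  rewrite (young_jm_power (@chi_rhoM n i) (tab_corner sz (intpart_sorted la))
    (tab_row_pos sz) (tab_col_pos sz (intpart_sorted la)) (@tab_inj la n)).
  by rewrite scalerA /= [in RHS]rmorphM /= [in RHS]rmorphXn /= rmorphB /= !ratr_nat.
move/eqP; rewrite -subr_eq0 -scalerBl scaler_eq0 (negbTE (young_symmetrizer_neq0 sz cla)) orbF.
by rewrite subr_eq0 => /eqP.
Qed.

End Shape.

Lemma young_group_fiber_stab n s : young_group n s = fiber_stab (@tab_row s n) n :> {set _}.
Proof. by apply/setP => g; rewrite fiber_stab_full inE. Qed.

(** The inner product conjugates its second argument; conjugating a whole sum preserves whether it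
    vanishes. *)
Lemma sum_conjC_neq0 (gT : finGroupType) (A : {set gT}) (F : gT -> algC) :
  (\sum_(g in A) (F g)^* != 0) = (\sum_(g in A) F g != 0).
Proof. by rewrite -rmorph_sum fmorph_eq0. Qed.

Lemma row_constt n s (i : Iirr [set: 'S_n]) :
  (i \in irr_constt ('Ind[[set: 'S_n]] (1 : 'CF(young_group n s)))) =
  (\tr (stab_sum ('Chi_i : 'S_n -> _) false (@tab_row s n) n) != 0).
Proof.
rewrite irr_consttE -Frobenius_reciprocity cfdotE mulf_eq0 negb_or invr_eq0 neq0CG /=.
rewrite tr_stab_sum -[RHS]sum_conjC_neq0 -young_group_fiber_stab; congr (_ != 0).
apply: eq_bigr => g gH; rewrite cfun1E gH mul1r cfResE ?subsetT //.
by rewrite /sgnb expr0 mul1r.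
Qed.

Lemma sum_fiber_stab_perm n (f : 'I_n -> nat) (p : 'S_n) (b : bool)
    (i : Iirr [set: 'S_n]) :
  \tr (stab_sum ('Chi_i : 'S_n -> _) b (f \o p) n) =
  \tr (stab_sum ('Chi_i : 'S_n -> _) b f n).
Proof.
rewrite !tr_stab_sum [RHS](reindex_inj (conjg_inj p)) /=; apply: eq_big => g.
  rewrite !fiber_stab_full; apply/forallP/forallP => h x.
    by have := h (p^-1%g x); rewrite -[x in f (_ x)](permKV p) permJ /= permKV.
  by have := h (p x); rewrite permJ.
by rewrite /sgnb odd_permJ cfunJgen ?inE // genGid inE.
Qed.

(** The Young subgroup of the conjugate partition permutes consecutive blocks, which are not the
    columns of the tableau. The fibers have equal sizes, so the two groups are conjugate and the
    traces agree. *)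
Lemma col_constt n la (i : Iirr [set: 'S_n]) : psize la = n ->
  (i \in irr_constt ('Ind[[set: 'S_n]]
      ('Res[young_group n (conj_parts la)] (sign_cfun n)))) =
  (\tr (stab_sum ('Chi_i : 'S_n -> _) true (@tab_col la n) n) != 0).
Proof.
move=> sz; have sort_la := intpart_sorted la.
have [|p def_p] := @perm_of_fibers n (@tab_col la n) (@tab_row (conj_parts la) n).
  move=> j; rewrite (card_tab_col sz) // card_tab_row ?nth_conj_parts //.
  by rewrite sumn_conj_parts.
rewrite -(sum_fiber_stab_perm _ p).
have -> : tab_col la (n:=n) \o p = @tab_row (conj_parts la) n.
  by apply: boolp.funext => x; rewrite /= def_p.
rewrite irr_consttE -Frobenius_reciprocity cfdotE mulf_eq0 negb_or invr_eq0 neq0CG /=.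
rewrite tr_stab_sum -[RHS]sum_conjC_neq0 -young_group_fiber_stab; congr (_ != 0).
apply: eq_bigr => g gH; rewrite !cfResE ?subsetT // cfunE.
by rewrite /sgnb /= rmorphM rmorphXn rmorphN1.
Qed.

Lemma chi_index_constt la : row_col_constt (chi_index la) la.
Proof.
rewrite /chi_index; case: pickP => [i /andP[]|no_i] /=.
  by rewrite row_constt col_constt // /row_col_constt => -> ->.
have [i] := @ex_row_col_constt (psize la) la erefl.
rewrite /row_col_constt -row_constt -col_constt // => ci.
by have := no_i i; rewrite ci.
Qed.

Lemma row_col_constt_cast n n' (e : n = n') la (i : Iirr [set: 'S_n]) :
  row_col_constt i la ->
  row_col_constt (ecast k (Iirr [set: 'S_k]) e i) la.
Proof. by case: n' / e. Qed.

(** * Cycle types *)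

Section RowRotation.
Variables (s : seq nat) (n : nat).
Hypothesis sum_s : sumn s = n.
Local Notation r := (@tab_row s n).
Local Notation c := (@tab_col s n).

(** Cyclic shift within a row. When [sumn s = n] the computed index is a cell of the diagram, so
    [insubd] does not fall back on [x]. *)
Definition row_next (x : 'I_n) : 'I_n :=
  insubd x (flatten_index s (r x) (if ((c x).+1 < nth 0 s (r x))%N then (c x).+1 else 0%N)).

Lemma row_nextP x : r (row_next x) = r x /\
  c (row_next x) = if ((c x).+1 < nth 0 s (r x))%N then (c x).+1 else 0%N.
Proof.
have lt_c := tab_colP sum_s x.
set j := if _ then _ else _; have lt_j : (j < nth 0 s (r x))%N.
  by rewrite /j; case: ifP => // _; apply: leq_ltn_trans lt_c.
have val_next : row_next x = flatten_index s (r x) j :> nat.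
  by rewrite val_insubd -/j -{2}sum_s flatten_indexP.
by rewrite /tab_row /tab_col val_next flatten_indexKl ?flatten_indexKr.
Qed.

Lemma row_next_inj : injective row_next.
Proof.
move=> x y e; have [[rx cx] [ry cy]] := (row_nextP x, row_nextP y).
have rxy : r x = r y by rewrite -rx -ry e.
apply: (tab_inj rxy); have := tab_colP sum_s x; have := tab_colP sum_s y.
by move: cx cy; rewrite e rxy => ->; do 2 case: ifP; lia.
Qed.

Definition row_rot : 'S_n := perm row_next_inj.

Lemma row_rot_pow x j : c x = 0%N -> (j < nth 0 s (r x))%N ->
  r ((row_rot ^+ j)%g x) = r x /\ c ((row_rot ^+ j)%g x) = j.
Proof.
move=> cx; elim: j => [|j IHj] lt_j; first by rewrite expg0 perm1.
have [rj cj] := IHj (ltnW lt_j); rewrite expgSr permM permE.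
by have [-> ->] := row_nextP ((row_rot ^+ j)%g x); rewrite rj cj lt_j.
Qed.

Lemma porbit_row_rot x : porbit row_rot x = [set y | r y == r x].
Proof.
have row_pow j y : r ((row_rot ^+ j)%g y) = r y.
  elim: j => [|j IHj]; first by rewrite expg0 perm1.
  by rewrite expgSr permM permE (row_nextP _).1.
have lt_x := tab_colP sum_s x.
have [|x0 r0 c0] := @tab_cell s n sum_s (r x) 0%N; first exact: leq_ltn_trans lt_x.
have reach y : r y = r x -> y \in porbit row_rot x0.
  move=> ry; have lt_y := tab_colP sum_s y; rewrite ry -r0 in lt_y.
  have [rj cj] := row_rot_pow c0 lt_y; apply/porbitP; exists (c y).
  by apply: (@tab_inj s n); rewrite ?rj ?cj ?r0 ?ry.
apply/setP => y; rewrite inE; apply/idP/eqP => [/porbitP[j ->]|/reach yx]; first exact: row_pow.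
by have := reach x erefl; rewrite -!eq_porbit_mem in yx * => /eqP->.
Qed.

Lemma cycle_lengths_row_rot : is_intpart s -> cycle_lengths row_rot = s.
Proof.
case/andP=> sort_s no0.
have tr : transitive geq by move=> a b d /= ab da; apply: leq_trans da ab.
apply: (@sorted_eq _ geq) => //.
- by move=> a b ba; apply/eqP; rewrite eqn_leq andbC.
- by apply: sort_sorted => a b; rewrite /= leq_total.
rewrite (permPl (permEl (perm_sort _ _))).
pose row i := [set y : 'I_n | r y == i].
have rowP (i : nat) : (i < size s)%N -> exists x, porbit row_rot x = row i.
  move=> lt_i; have [|x rx _] := @tab_cell s n sum_s i 0%N.
    by rewrite lt0n; apply: contraNneq no0 => <-; apply: mem_nth.
  by exists x; rewrite porbit_row_rot rx.
have perm_rows : perm_eq (enum (porbits row_rot)) [seq row i | i <- iota 0 (size s)].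
  apply: uniq_perm; rewrite ?enum_uniq //.
    rewrite map_inj_in_uniq ?iota_uniq // => i j; rewrite !mem_iota /= !add0n => lti ltj eq_row.
    have [x] := rowP _ lti; rewrite porbit_row_rot => ex.
    have : x \in row i by rewrite -ex inE.
    by move=> xi; move: (xi); rewrite eq_row !inE => /eqP <-; move: xi; rewrite inE => /eqP.
  move=> B; rewrite mem_enum; apply/imsetP/mapP => [[x _ ->]|[i]].
    exists (r x); rewrite ?porbit_row_rot // mem_iota /=.
    by rewrite add0n; apply: reshape_indexP; rewrite sum_s.
  by rewrite mem_iota add0n => /= /rowP[x ex] ->; exists x.
rewrite (perm_trans (perm_map _ perm_rows)) // -map_comp.
rewrite (_ : map _ _ = s) //; apply: (@eq_from_nth _ 0%N); rewrite ?size_map ?size_iota //.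
move=> i lt_i; rewrite (nth_map 0%N) ?size_iota // nth_iota //= add0n.
exact: (card_tab_row sum_s).
Qed.

End RowRotation.

Lemma ex_cycle_type (mu : intpart) : exists w : 'S_(psize mu), cycle_type w = mu.
Proof.
exists (@row_rot mu _ erefl); apply: val_inj => /=.
by apply: cycle_lengths_row_rot; apply: partsP.
Qed.

(* The row rotation of its cycle lengths is a normal form of a permutation:   *)
(* entry [(i, j)] corresponds to the [j]-th image of the chosen point of the  *)
(* [i]-th cycle.                                                              *)
Lemma cycle_type_row_rot n (w : 'S_n) (sz : sumn (cycle_lengths w) = n) :
  exists g : 'S_n, (row_rot sz ^ g)%g = w.
Proof.
pose leC := relpre (fun B : {set 'I_n} => #|B|) geq.
pose L := sort leC (enum (porbits w)).
have defs : cycle_lengths w = [seq #|B| | B : {set 'I_n} <- L].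
  by rewrite /cycle_lengths sort_map.
set s := cycle_lengths w in sz defs *.
have uniqL : uniq L by rewrite sort_uniq enum_uniq.
pose r := @tab_row s n; pose c := @tab_col s n.
have lt_r x : (r x < size L)%N.
  have : (r x < size s)%N by apply: reshape_indexP; rewrite sz.
  by rewrite defs size_map.
have nth_s x : nth 0%N s (r x) = #|nth set0 L (r x)| by rewrite defs (nth_map set0).
have repP x : exists y, porbit w y == nth set0 L (r x).
  have := mem_nth set0 (lt_r x); rewrite mem_sort mem_enum => /imsetP[y _ ->].
  by exists y.
(* The chosen point of a cycle must be the same for all entries of a row, which [eq_xchoose]
   ensures. *)
have [f fP] : exists f : 'I_n -> 'I_n, forall x, porbit w (f x) = nth set0 L (r x) /\
     (forall y, r x = r y -> f x = f y).
  exists (fun x => xchoose (repP x)) => x; split; first exact/eqP/(xchooseP (repP x)).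
  by move=> y rxy; apply: eq_xchoose => z /=; rewrite rxy.
pose g x := (w ^+ c x)%g (f x).
have lt_c x : (c x < #|porbit w (f x)|)%N.
  by rewrite (fP x).1 -nth_s; apply: tab_colP.
have g_inj : injective g.
  move=> x y gxy; have [[px fx] [py _]] := (fP x, fP y).
  have ePQ : porbit w (f x) = porbit w (f y).
    by rewrite -(porbit_perm w (c x)) -/(g x) gxy /g porbit_perm.
  have rxy : r x = r y.
    by apply/eqP; rewrite -(nth_uniq set0 (lt_r x) (lt_r y) uniqL) -px -py ePQ.
  apply: (tab_inj rxy); apply: (@perm_pow_inj _ w (f x)) => //.
    by rewrite ePQ; apply: lt_c.
  by rewrite -/(c x) -/(c y) [RHS](_ : _ = g y) // /g (fx y rxy).
have step x : w (g x) = g (row_next s x).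
  have [rn cn] := row_nextP sz x; rewrite -/(r _) in rn; rewrite -/(c _) in cn.
  have fn : f (row_next s x) = f x by rewrite ((fP (row_next s x)).2 x).
  rewrite /g fn cn -permM -expgSr; case: ifP => // /negbT; rewrite -leqNgt => le_c.
  have -> : (c x).+1 = #|porbit w (f x)|.
    apply/eqP; rewrite eqn_leq lt_c (fP x).1 -nth_s; exact: le_c.
  by rewrite expg0 perm1 permX iter_porbit.
exists (perm g_inj); apply/permP => y.
rewrite -[y](permKV (perm g_inj)) permJ !permE.
by rewrite step.
Qed.

Lemma same_cycle_type_conj n (w w' : 'S_n) :
  cycle_type w = cycle_type w' -> exists g, w' = (w ^ g)%g.
Proof.
move=> eq_ct; have eq_cl : cycle_lengths w = cycle_lengths w' by case: eq_ct.
have sz : sumn (cycle_lengths w) = n := psize_cycle_type w.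
have [g defw] := cycle_type_row_rot sz.
have [g' defw'] : exists g' : 'S_n, (row_rot sz ^ g')%g = w'.
  by case: _ / (esym eq_cl) sz {g defw} => sz; apply: cycle_type_row_rot.
by exists (g^-1 * g')%g; rewrite conjgM -defw conjgK defw'.
Qed.

(** * Embedding S_d into S_n along an injection *)

Section Embedding.
Variables (d n : nat) (h : 'I_d -> 'I_n).
Hypothesis injh : injective h.
Local Notation D := (h @: [set: 'I_d]).

Definition extend_fun (w : 'S_d) (x : 'I_n) : 'I_n :=
  if [pick j | h j == x] is Some j then h (w j) else x.

Lemma extend_funE w j : extend_fun w (h j) = h (w j).
Proof.
rewrite /extend_fun; case: pickP => [i /eqP/injh -> //|/(_ j)].
by rewrite eqxx.
Qed.

Lemma extend_fun_out w x : x \notin D -> extend_fun w x = x.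
Proof.
rewrite /extend_fun; case: pickP => [i /eqP <-|//].
by rewrite imset_f ?inE.
Qed.

Lemma extend_fun_inj w : injective (extend_fun w).
Proof.
have in_D y : y \in D -> extend_fun w y \in D.
  by case/imsetP => j _ ->; rewrite extend_funE imset_f ?inE.
move=> x y; have [xD|xD] := boolP (x \in D); have [yD|yD] := boolP (y \in D).
- case/imsetP: xD => i _ ->; case/imsetP: yD => j _ ->.
  by rewrite !extend_funE => /injh/perm_inj->.
- by move=> e; case/negP: (yD); rewrite -(extend_fun_out w yD) -e in_D.
- by move=> e; case/negP: (xD); rewrite -(extend_fun_out w xD) e in_D.
by rewrite !extend_fun_out.
Qed.

Definition extend w : 'S_n := perm (@extend_fun_inj w).

Lemma extendE w j : extend w (h j) = h (w j).
Proof. by rewrite permE extend_funE. Qed.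

Lemma extend_out w x : x \notin D -> extend w x = x.
Proof. by move=> xD; rewrite permE extend_fun_out. Qed.

Lemma extend_inj : injective extend.
Proof.
by move=> v w e; apply/permP => j; apply: injh; rewrite -!extendE e.
Qed.

Lemma perm_on_extend w : perm_on D (extend w).
Proof. by apply/subsetP => x; apply: contraNT => /extend_out ->. Qed.

Lemma extend_imset : extend @: [set: 'S_d] = [set v | perm_on D v].
Proof.
apply/eqP; rewrite eqEcard; apply/andP; split.
  by apply/subsetP => _ /imsetP[w _ ->]; rewrite inE perm_on_extend.
by rewrite cardsE card_perm (card_imset _ injh) (card_imset _ extend_inj) !cardsT card_Sn card_ord.
Qed.

Lemma sum_extend (V : nmodType) (F : 'S_n -> V) :
  \sum_(v | perm_on D v) F v = \sum_(w : 'S_d) F (extend w).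
Proof.
rewrite (eq_bigl (fun v => v \in [set v | perm_on D v])) => [|v]; last by rewrite inE.
rewrite -extend_imset big_imset /=; last by move=> v w _ _; apply: extend_inj.
by apply: eq_bigl => w; rewrite inE.
Qed.

Lemma extend_pow w i j : (extend w ^+ i)%g (h j) = h ((w ^+ i)%g j).
Proof.
by elim: i => [|i IHi]; rewrite ?expg0 ?perm1 // !expgSr !permM IHi extendE.
Qed.

Lemma porbit_extend w j : porbit (extend w) (h j) = h @: porbit w j.
Proof.
apply/setP => y; apply/porbitP/imsetP => [[i ->]|[z /porbitP[i ->] ->]].
  by exists ((w ^+ i)%g j); rewrite ?mem_porbit // extend_pow.
by exists i; rewrite extend_pow.
Qed.

Lemma porbit_extend_out w x : x \notin D -> porbit (extend w) x = [set x].
Proof.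
move=> xD; apply/setP => y; rewrite inE; apply/porbitP/eqP => [[i ->]|->]; last first.
  by exists 0%N; rewrite expg0 perm1.
by elim: i => [|i IHi]; rewrite ?expg0 ?perm1 // expgSr permM IHi extend_out.
Qed.

Lemma imset_h_inj : injective (fun B : {set 'I_d} => h @: B).
Proof. exact: imset_inj. Qed.

Lemma porbits_extend_in w :
  [set B in porbits (extend w) | B \subset D] =
  (fun B : {set 'I_d} => h @: B) @: porbits w.
Proof.
apply/setP => B; rewrite inE; apply/andP/imsetP => [[/imsetP[x _ ->] sub]|[_ /imsetP[j _ ->] ->]].
  have /imsetP[j _ defx] := subsetP sub _ (porbit_id _ x).
  by exists (porbit w j); rewrite ?imset_f // defx porbit_extend.
by rewrite -porbit_extend imset_f // porbit_extend imsetS // subsetT.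
Qed.

Lemma cycle_ser_extend w : cycle_ser D (extend w) = cycle_ser [set: 'I_d] w.
Proof.
rewrite /cycle_ser porbits_extend_in card_imset //; congr (_ * (_ * _)).
rewrite big_imset /=; last by move=> A B _ _; apply: imset_h_inj.
rewrite (_ : [set B in porbits w | _] = porbits w).
  by apply: eq_bigr => B _; rewrite card_imset.
by apply/setP => B; rewrite inE subsetT andbT.
Qed.

Lemma cycle_lengths_extend w :
  cycle_lengths (extend w) = cycle_lengths w ++ nseq (n - d) 1%N.
Proof.
have tr : transitive geq by move=> a b e /= ab da; apply: leq_trans da ab.
apply: (@sorted_eq _ geq) => //.
- by move=> a b ba; apply/eqP; rewrite eqn_leq andbC.
- by apply: sort_sorted => a b; rewrite /= leq_total.
- rewrite sorted_pairwise // pairwise_cat -!sorted_pairwise //.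
  have /andP[-> no0] := cycle_lengths_intpart w; rewrite andTb.
  apply/andP; split; last by elim: (n - d)%N => // -[|m].
  apply/allrelP => a b a_in /nseqP[-> _] /=.
  by rewrite lt0n; apply: contraNneq no0 => <-.
rewrite (permPl (permEl (perm_sort _ _))).
have -> : (n - d)%N = #|~: D| by rewrite cardsCs setCK card_imset // cardsT !card_ord.
rewrite perm_sym perm_catC; set ones := nseq _ _.
have -> : ones = [seq #|B| | B : {set 'I_n} <- [seq [set x] | x <- enum (~: D)]].
  rewrite -map_comp /ones cardE; elim: (enum _) => //= x s <-.
  by rewrite cards1.
pose card_seq (t : seq {set 'I_n}) := [seq #|B| | B : {set 'I_n} <- t].
pose points := [seq [set x] | x <- enum (~: D)].
pose cycles := [seq h @: B | B : {set 'I_d} <- enum (porbits w)].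
have pl : perm_eq (cycle_lengths w) (card_seq cycles).
  rewrite (permPl (permEl (perm_sort _ _))) /card_seq /cycles -map_comp.
  by rewrite (eq_map (g := fun B : {set 'I_d} => #|B|)) // => B /=; rewrite card_imset.
rewrite (perm_trans (y := card_seq points ++ card_seq cycles)) ?perm_cat2l // -map_cat.
apply: perm_map; apply: uniq_perm; rewrite ?enum_uniq //.
  rewrite cat_uniq !map_inj_uniq ?enum_uniq //; first last.
  - exact: set1_inj.
  - exact: imset_h_inj.
  rewrite andbT andTb; apply/hasPn => _ /mapP[B + ->]; rewrite mem_enum => /imsetP[j _ ->].
  apply/negP => /mapP[x]; rewrite mem_enum inE => xD ex; case/negP: xD.
  by rewrite -[x \in _]/(x \in D) (subsetP (imsetS h (subsetT (porbit w j)))) // ex inE.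
move=> B; rewrite mem_cat mem_enum; apply/orP/imsetP => [[/mapP[x]|/mapP[A]]|[x _ ->]].
- by rewrite mem_enum inE => xD ->; exists x; rewrite // porbit_extend_out.
- by rewrite mem_enum => /imsetP[j _ ->] ->; exists (h j); rewrite // porbit_extend.
have [/imsetP[j _ ->]|xD] := boolP (x \in D).
  by right; rewrite porbit_extend map_f // mem_enum imset_f.
by left; rewrite porbit_extend_out // map_f // mem_enum inE.
Qed.

End Embedding.

(** [chi_at] picks some permutation of the padded cycle type; all of them are conjugate. *)
Lemma chi_at_extend la d (h : 'I_d -> 'I_(psize la)) (injh : injective h) (w : 'S_d) :
  chi_at la (cycle_type w) = chi la (extend injh w).
Proof.
have ct : parts (cycle_type (extend injh w)) ==
    parts (cycle_type w) ++ nseq (psize la - psize (cycle_type w)) 1%N.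
  by rewrite psize_cycle_type /= cycle_lengths_extend.
rewrite /chi_at; case: pickP => [v /eqP ev|/(_ (extend injh w))]; last by rewrite ct.
have /same_cycle_type_conj[g ->] : cycle_type v = cycle_type (extend injh w).
  by apply: val_inj; apply: etrans ev (esym (eqP ct)).
by rewrite cfunJgen // genGid inE.
Qed.

Lemma f_class_size la d (w : 'S_d) : (d <= psize la)%N ->
  f_ (cycle_type w) la / (class_size (cycle_type w))%:R =
  'C(psize la, d)%:R * chi_at la (cycle_type w) / dim_chi la.
Proof.
move=> le_d; rewrite /f_ psize_cycle_type le_d.
have cs0 : (class_size (cycle_type w))%:R != 0 :> algC.
  rewrite pnatr_eq0 /class_size -lt0n card_gt0; apply/set0Pn.
  have [v] := ex_cycle_type (cycle_type w); exists v.
  by rewrite inE; apply/eqP.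
have d0 : dim_chi la != 0 by apply: irr1_neq0.
by field; rewrite d0 cs0.
Qed.

Lemma phiE (x : grpalgs) la : phi x la =
  (\sum_(d < (psize la).+1) 'C(psize la, d)%:R *
     \sum_(w : 'S_d) ratr (x d w) * chi_at la (cycle_type w)) / dim_chi la.
Proof.
rewrite /phi mulr_suml; apply: eq_bigr => d _; rewrite -mulrA mulr_suml mulr_sumr.
apply: eq_bigr => w _; rewrite f_class_size -1?ltnS //.
by ring.
Qed.

(** The binomial coefficient in [f_] counts the sets [D], and each of them contributes the same sum
    over a copy of S_d. *)
Lemma sum_sized_subsets la d (F : pser -> algC) :
  \sum_(D : {set 'I_(psize la)} | #|D| == d) \sum_(v | perm_on D v)
      F (cycle_ser D v) * chi la v =
  'C(psize la, d)%:R * \sum_(w : 'S_d) F (cycle_ser [set: 'I_d] w) * chi_at la (cycle_type w).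
Proof.
have -> : 'C(psize la, d) = #|[set D : {set 'I_(psize la)} | #|D| == d]|.
  by rewrite card_draws card_ord.
rewrite -sum1_card natr_sum mulr_suml.
rewrite (eq_bigl (fun D => D \in [set D : {set 'I_(psize la)} | #|D| == d])) => [|D]; last by rewrite inE.
apply: eq_bigr => D; rewrite inE mul1r => /eqP cardD.
pose h (j : 'I_d) : 'I_(psize la) := enum_val (cast_ord (esym cardD) j).
have injh : injective h by move=> i j /enum_val_inj; apply: cast_ord_inj.
have imh : h @: [set: 'I_d] = D.
  apply/eqP; rewrite eqEcard card_imset // cardsT card_ord cardD leqnn andbT.
  by apply/subsetP => _ /imsetP[j _ ->]; apply: enum_valP.
clearbody h; case: D / imh {cardD}; rewrite (sum_extend injh); apply: eq_bigr => w _.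
by rewrite (chi_at_extend injh) (cycle_ser_extend injh).
Qed.

(** * The completion coefficients *)

Definition pser_X : pser := fun n => (n == 1)%N%:R.

Lemma pser_coefXM (a : pser) n : (pser_X * a) n = if n is m.+1 then a m else 0.
Proof.
rewrite pser_coefM big_ord_recl mul0r add0r; case: n => [|n]; first by rewrite big_ord0.
rewrite big_ord_recl big1 => [|i _]; last by rewrite mul0r.
by rewrite mul1r addr0 /= subn1.
Qed.

Lemma pser_coefXnM (a : pser) j n :
  (pser_X ^+ j * a) n = if (n < j)%N then 0 else a (n - j)%N.
Proof.
elim: j n => [|j IHj] n; first by rewrite mul1r subn0.
by rewrite exprS -mulrA pser_coefXM; case: n => //= n; rewrite IHj.
Qed.

Lemma pser_X_inj (a b : pser) : pser_X * a = pser_X * b -> a = b.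
Proof.
by move=> e; apply: pserP => n; have := congr1 (fun x : pser => x n.+1) e; rewrite !pser_coefXM.
Qed.

Lemma pser_scaleM c (a b : pser) : pser_scale c (a * b) = pser_scale c a * pser_scale c b.
Proof.
apply: pserP => n; rewrite /pser_scale !pser_coefM mulr_sumr; apply: eq_bigr => i _.
by rewrite mulrACA -exprD subnKC // -ltnS.
Qed.

Lemma pser_scaleB c (a b : pser) : pser_scale c (a - b) = pser_scale c a - pser_scale c b.
Proof. by apply: pserP => n; rewrite /pser_scale !pser_coefB mulrBr. Qed.

Lemma pser_scale_one c : pser_scale c 1 = 1.
Proof. by apply: pserP => -[|n]; rewrite /pser_scale !pser_coef1 /= ?mulr0 ?mul1r. Qed.

Lemma pser_scale1 (a : pser) : pser_scale 1 a = a.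
Proof. by apply: pserP => n; rewrite /pser_scale expr1n mul1r. Qed.

Lemma pser_scale_X c : pser_scale c pser_X = pser_const c * pser_X.
Proof.
apply: pserP => n; rewrite pser_coefZ /pser_scale /pser_X.
by case: n => [|[|n]]; rewrite /= ?expr1 ?mulr0.
Qed.

Lemma pser_scale_expc c a : pser_scale c (pser_expc a) = pser_expc (c * a).
Proof. by apply: pserP => n; rewrite /pser_scale /pser_expc exprMn mulrA. Qed.

Lemma sh2_S_ser c : sh2 c = pser_const c%:R * (pser_X * pser_scale c%:R S_ser).
Proof.
apply: pserP => n; rewrite pser_coefZ pser_coefXM /sh2 /exph /exphN -!pser_expcMn.
rewrite pser_coefB /pser_expc.
case: n => [|n]; first by rewrite !expr0 subrr mulr0.
rewrite /pser_scale /S_ser /sinh_half mulrA -exprS -mulrBl mulNrn [(- _) ^+ _]exprNn.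
rewrite -signr_odd; case: ifP => odd_n; last by rewrite expr0 mul1r subrr mul0r !mulr0.
rewrite expr1 mulN1r opprK -[2^-1 *+ c]mulr_natr exprMn exprVn invfM.
by ring.
Qed.

Lemma pser_expE (a : pser) n : pser_exp a n = a ^+ n.
Proof. by elim: n => // n IHn; rewrite exprS -IHn. Qed.

Lemma pser_invP (a : pser) : a 0%N != 0 -> pser_inv a * a = 1.
Proof.
move=> a0; have size_seq m : size (pser_inv_seq a m) = m.
  by elim: m => //= m IHm; rewrite size_rcons IHm.
have nth_seq m i : (i < m)%N -> (pser_inv_seq a m)`_i = pser_inv a i.
  elim: m => // m IHm; rewrite ltnS leq_eqVlt => /orP[/eqP->//|lt_im].
  by rewrite /= nth_rcons size_seq lt_im IHm.
apply: pserP => n; rewrite pser_coefM big_ord_recr /= subnn.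
rewrite {2}/pser_inv /= nth_rcons size_seq ltnn eqxx divfK //.
rewrite (eq_bigr (fun i : 'I_n => (pser_inv_seq a n)`_i * a (n - i)%N)) => [|i _].
  by rewrite addrC subrK pser_coef1.
by rewrite nth_seq.
Qed.

(** * Bernoulli numbers and the inverse of S *)

Lemma bernoulli_sum n : \sum_(j < n.+1) 'C(n.+1, j)%:R * bernoulli j = (n == 0)%N%:R.
Proof.
have size_seq m : size (bernoulli_seq m) = m.
  by elim: m => //= m IHm; rewrite size_rcons IHm.
have nth_seq m i : (i < m)%N -> (bernoulli_seq m)`_i = bernoulli i.
  elim: m => // m IHm; rewrite ltnS leq_eqVlt => /orP[/eqP->//|lt_im].
  by rewrite /= nth_rcons size_seq lt_im IHm.
rewrite big_ord_recr /= binSn {2}/bernoulli /= nth_rcons size_seq ltnn eqxx.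
rewrite [n.+1%:R * _]mulrC divfK ?pnatr_eq0 //.
rewrite (eq_bigr (fun i : 'I_n => 'C(n.+1, i)%:R * (bernoulli_seq n)`_i)) => [|i _].
  by rewrite addrC subrK.
by rewrite nth_seq.
Qed.

Definition bern_ser : pser := fun n => bernoulli n / n`!%:R.

Lemma bern_ser_expc : bern_ser * (pser_expc 1 - 1) = pser_X.
Proof.
have fact0 m : m`!%:R != 0 :> rat by rewrite pnatr_eq0 -lt0n fact_gt0.
apply: pserP => -[|n]; rewrite pser_coefM.
  by rewrite big_ord1 pser_coefB pser_coef1 /pser_expc /= expr0 divr1 subrr mulr0.
rewrite big_ord_recr /= subnn [X in _ + _ * X](_ : _ = 0) ?mulr0 ?addr0; last first.
  by rewrite pser_coefB pser_coef1 /pser_expc /= expr0 divr1 subrr.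
transitivity (n.+1`!%:R^-1 * \sum_(j < n.+1) 'C(n.+1, j)%:R * bernoulli j : rat).
  rewrite mulr_sumr; apply: eq_bigr => j _; have le_jn := ltnW (ltn_ord j).
  rewrite -(bin_fact le_jn) pser_coefB pser_coef1 /pser_expc expr1n.
  have -> : (n.+1 - j == 0)%N = false by rewrite subn_eq0 leqNgt ltn_ord.
  rewrite subr0 /bern_ser !natrM.
  have b0 : 'C(n.+1, j)%:R != 0 :> rat by rewrite pnatr_eq0 -lt0n bin_gt0.
  have [f1 f2] := (fact0 j, fact0 (n.+1 - j)%N).
  move: b0 f1 f2; move: ('C(_, _)%:R) (j`!%:R) ((n.+1 - j)`!%:R) => x y z x0 y0 z0.
  by field; rewrite x0 y0 z0.
rewrite bernoulli_sum /pser_X eqSS; case: n => [|n]; last by rewrite mulr0.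
by rewrite mulr1.
Qed.

(** With w = e^(z/2), 1/S(z) = z w/(w^2 - 1), and partial fractions give w/(w^2 - 1) = 1/(w - 1) -
    1/(w^2 - 1). Both terms are Bernoulli series. *)
Lemma S_ser_inv : pser_inv S_ser =
  pser_const 2 * pser_scale 2^-1 bern_ser - bern_ser.
Proof.
set T := _ - bern_ser; have S0 : S_ser 0%N != 0 by [].
suff ST : S_ser * T = 1.
  by rewrite -[LHS]mulr1 -ST mulrA pser_invP // mul1r.
apply: pser_X_inj; rewrite mulr1 mulrA.
have -> : pser_X * S_ser = exph - exphN.
  by rewrite -[S_ser]pser_scale1 -[LHS]mul1r -(rmorph1 pser_const) -(sh2_S_ser 1) /sh2 !expr1.
have uv := exph_mulV.
have b1 : bern_ser * (exph * exph - 1) = pser_X.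
  rewrite -bern_ser_expc -pser_expcD; congr (_ * (pser_expc _ - _)).
have b2 : pser_const 2 * pser_scale 2^-1 bern_ser * (exph - 1) = pser_X.
  have := congr1 (pser_scale 2^-1) bern_ser_expc.
  rewrite pser_scaleM pser_scaleB pser_scale_one pser_scale_expc mulr1 pser_scale_X => e.
  by rewrite -mulrA e mulrA -rmorphM mulfV // rmorph1 mul1r.
have fac : exph - exphN = exphN * (exph * exph - 1).
  by rewrite mulrBr mulrA [exphN * _]mulrC uv mul1r mulr1.
have fac' : exph * exph - 1 = (exph - 1) * (exph + 1) by ring.
rewrite /T mulrBr {1}fac {1}fac' fac.
set P := _ * pser_scale _ _ in b2 *.
transitivity (exphN * (exph + 1) * (P * (exph - 1)) - exphN * (bern_ser * (exph * exph - 1))).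
  by ring.
rewrite b1 b2; transitivity (exph * exphN * pser_X); first by ring.
by rewrite uv mul1r.
Qed.

Definition completion_formula (k : nat) (mu : intpart) : rat :=
  (k - 1)`!%:R * ((\prod_(m <- mu) m%:R) / (psize mu)`!%:R) *
    pser_coef (k%:Z + 1 - (psize mu)%:Z - (size mu)%:Z)
      (pser_mul (pser_expz S_ser ((psize mu)%:Z - 1))
         (\big[pser_mul/pser_one]_(m <- mu) pser_scale m%:R S_ser)).

(** For d = 0 the power of S is 1/S, whose coefficient of z^(k+1) is (2^(-k) - 1) B_(k+1)/(k+1)!. *)
Lemma completion_formula_nil k (mu : intpart) : (1 <= k)%N -> psize mu = 0%N ->
  k%:R * completion_formula k mu = (1 - 2 ^- k) * zeta_neg k.
Proof.
move=> k1 sz; have mu0 : parts mu = [::].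
  have /andP[_] := partsP mu; move: sz; rewrite /psize; case: (parts mu) => //= p s.
  by move/eqP; rewrite addn_eq0 inE negb_or eq_sym => /andP[-> _].
rewrite /completion_formula sz mu0 !big_nil.
have -> : 1 / 0`!%:R = 1 :> rat by [].
have -> : k%:Z + 1 - 0%Z - (size ([::] : seq nat))%:Z = Posz k.+1.
  by rewrite /= !subr0 -[1]/(Posz 1) -PoszD addn1.
have -> : pser_expz S_ser (0%Z - 1) = pser_inv S_ser by apply: (mulr1 (pser_inv S_ser)).
rewrite mulr1 -[pser_mul _ _]/(pser_inv S_ser * 1) mulr1 /pser_coef.
rewrite S_ser_inv pser_coefB pser_coefZ /pser_scale /bern_ser /zeta_neg.
case: k k1 => // k _; rewrite subn1 -[k.+1.-1]/k [LHS]mulrA -natrM -factS.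
rewrite [k.+2`!]factS natrM exprVn exprS invfM.
have f0 : k.+1`!%:R != 0 :> rat by rewrite pnatr_eq0 -lt0n fact_gt0.
have k0 : k.+2%:R != 0 :> rat by rewrite pnatr_eq0.
have t0 : 2 ^+ k.+1 != 0 :> rat by rewrite expf_neq0.
move: f0 k0 t0; move: (k.+1`!%:R) (k.+2%:R) (2 ^+ k.+1) (bernoulli _) => x y z b x0 y0 z0.
by field; rewrite x0 y0 z0.
Qed.

(** Every factor [sh2 m] is m z S(m z). The cycle lengths produce the product of the parts, and the
    d - 1 + l factors z lower the degree from k to k + 1 - d - l = 2g. *)
Lemma completion_formula_cycle_ser k d (w : 'S_d) : (1 <= k)%N -> (0 < d)%N ->
  k%:R * completion_formula k (cycle_type w) = fact_coef k (cycle_ser [set: 'I_d] w).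
Proof.
move=> k1 d0; rewrite /completion_formula psize_cycle_type; set mu := cycle_type w.
have -> : cycle_ser [set: 'I_d] w =
   pser_const (d`!%:R^-1) * (sh2 1 ^+ d.-1 * \prod_(m <- mu) sh2 m).
  rewrite /cycle_ser cardsT card_ord; congr (_ * (_ * _)).
  rewrite /mu /= /cycle_lengths (perm_big _ (permEl (perm_sort _ _))) /= big_map big_enum.
  by apply: eq_bigl => B; rewrite inE subsetT andbT.
have -> : \prod_(m <- mu) sh2 m = pser_const (\prod_(m <- mu) m%:R) *
    (pser_X ^+ size mu * \prod_(m <- mu) pser_scale m%:R S_ser).
  elim: (parts mu) => [|m s IHs]; first by rewrite !big_nil rmorph1 !mul1r.
  by rewrite !big_cons IHs sh2_S_ser rmorphM /= exprS; ring.
have -> : sh2 1 ^+ d.-1 = pser_X ^+ d.-1 * S_ser ^+ d.-1.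
  by rewrite -exprMn sh2_S_ser rmorph1 mul1r pser_scale1.
have -> : d%:Z - 1 = Posz d.-1 by case: d d0 {w mu} => // d _; rewrite -predn_int.
rewrite /= pser_expE; set P := \prod_(m <- mu) pser_scale _ _.
rewrite -[pser_mul _ _]/(S_ser ^+ d.-1 * P).
set c := \prod_(m <- mu) m%:R.
have -> : pser_const d`!%:R^-1 * (pser_X ^+ d.-1 * S_ser ^+ d.-1 *
   (pser_const c * (pser_X ^+ size mu * P))) =
   pser_const (c / d`!%:R) * (pser_X ^+ (d.-1 + size mu) * (S_ser ^+ d.-1 * P)).
  rewrite [pser_const (c / _)]rmorphM exprD /=.
  move: (pser_const _) (pser_const c) (pser_X ^+ d.-1) (pser_X ^+ size mu) (S_ser ^+ d.-1) P.
  by move=> a1 a2 a3 a4 a5 a6; ring.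
rewrite /fact_coef pser_coefZ pser_coefXnM.
have -> : k`!%:R = k%:R * (k - 1)`!%:R :> rat.
  by rewrite -natrM; case: k k1 => // k _; rewrite subn1.
rewrite -!mulrA; do 4 congr (_ * _).
(* If z^(d-1+l) exceeds degree k, then 2g is negative and [pser_coef] is 0 by definition. *)
case: ltnP => [lt_k|le_k].
  have [m ->] : exists m, k%:Z + 1 - d%:Z - (size mu)%:Z = Negz m.
    exists (d.-1 + size mu - k).-1; rewrite NegzE; lia.
  by [].
have -> : k%:Z + 1 - d%:Z - (size mu)%:Z = Posz (k - (d.-1 + size mu))%N by lia.
by [].
Qed.

(** Row i has the contents j - i for j below its length. There [shift_diff] is the increment of (j -
    i - 1/2)^k, so the row telescopes to its summand in [p_]; rows are counted from 0, and -(i + 1)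
    + 1/2 is -i - 1/2. *)
Lemma p_contents k la n : psize la = n -> p_ k la =
  \sum_(x : 'I_n) shift_diff k ((tab_col la x)%:R - (tab_row la x)%:R)
  + (1 - 2 ^- k) * zeta_neg k.
Proof.
move=> sz; rewrite /p_; congr (_ + _).
have lt_r (x : 'I_n) : (tab_row la x < size la)%N.
  by apply: reshape_indexP; rewrite -[sumn la]/(psize la) sz.
rewrite [RHS](partition_big (fun x => Ordinal (lt_r x)) predT) //=.
apply: eq_bigr => i _.
transitivity (\sum_(x : 'I_n | tab_row la x == i) shift_diff k ((tab_col la x)%:R - i%:R)).
  rewrite (sum_tab_row sz _ (fun j => shift_diff k (j%:R - i%:R))).
  pose F j : rat := (j%:R - i%:R - 2^-1) ^+ k.
  transitivity (F (nth 0%N la i) - F 0%N).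
    by rewrite /F -[i.+1]addn1 natrD; congr (_ ^+ k - _ ^+ k); field.
  rewrite -telescope_sumr // big_mkord; apply: eq_bigr => j _.
  rewrite /F /shift_diff -[j.+1]addn1 natrD; congr (_ ^+ k - _).
  by field.
apply: eq_big => [x|x /eqP-> //]; by rewrite -val_eqE.
Qed.

Lemma chi_at_chi d la (e : psize la = d) (v : 'S_d) :
  chi_at la (cycle_type v) = 'chi_(ecast k (Iirr [set: 'S_k]) e (chi_index la)) v.
Proof.
case: d / e v => v; have injid : injective (@id 'I_(psize la)) by [].
rewrite (chi_at_extend injid) (_ : extend injid v = v) //.
by apply/permP => x; rewrite -[in LHS](erefl : id x = x) extendE.
Qed.

(** There are as many irreducible characters as conjugacy classes, and sending a class to the
    character of its cycle type is injective, hence onto. *)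
Lemma irr_chi_index d (i : Iirr [set: 'S_d]) : exists la (e : psize la = d),
  i = ecast k (Iirr [set: 'S_k]) e (chi_index la).
Proof.
pose F (w : 'S_d) := ecast k (Iirr [set: 'S_k]) (psize_cycle_type w) (chi_index (cycle_type w)).
have F_constt w : row_col_constt (F w) (cycle_type w).
  exact/row_col_constt_cast/chi_index_constt.
have F_conj v w : F v = F w -> exists g, w = (v ^ g)%g.
  move=> eF; apply: same_cycle_type_conj.
  by apply: (row_col_constt_inj _ _ (F_constt v)); rewrite ?psize_cycle_type // eF.
have inj : {in classes [set: 'S_d] &, injective (F \o repr)}.
  move=> A B /imsetP[v _ ->] /imsetP[w _ ->] /=.
  have [v' v'v] : exists a, repr (v ^: [set: 'S_d])%g = (v ^ a)%g.
    by have /imsetP[a _ ->] := mem_repr v (class_refl [set: 'S_d] v); exists a.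
  have [w' w'w] : exists a, repr (w ^: [set: 'S_d])%g = (w ^ a)%g.
    by have /imsetP[a _ ->] := mem_repr w (class_refl [set: 'S_d] w); exists a.
  rewrite v'v w'w => /F_conj[g eg].
  have : ((v ^ v') ^ g)%g \in (w ^: [set: 'S_d])%g by rewrite -eg memJ_class ?inE.
  move/class_eqP <-; apply/esym/class_eqP; rewrite -conjgM memJ_class ?inE //.
have : i \in (F \o repr) @: classes [set: 'S_d].
  rewrite (_ : _ @: _ = setT) ?inE //; apply/eqP.
  by rewrite eqEcard subsetT cardsT card_ord (card_in_imset inj) NirrE leqnn.
by case/imsetP => A _ ->; exists (cycle_type (repr A)), (psize_cycle_type _).
Qed.

(** * Injectivity of phi *)

Definition is_class_function d (x : grpalg d) := forall w g : 'S_d, x (w ^ g)%g = x w.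

Lemma in_centerP d (x : grpalg d) : in_center x <-> is_class_function x.
Proof.
split=> [cx w g|cx y]; apply/eqP.
  have := cx [ffun u => (u == g)%:R] => /(congr1 (fun z : grpalg d => z (w * g)%g)).
  rewrite !ffunE (bigD1 w) //= ffunE mulKg eqxx mulr1 big1 ?addr0 => [|u ne_u].
    rewrite (bigD1 g) //= ffunE eqxx mul1r big1 ?addr0 => [->|u /negbTE ne_u].
      by rewrite conjgE.
    by rewrite ffunE ne_u mul0r.
  rewrite ffunE; case: eqP => [eu|]; last by rewrite mulr0.
  case/eqP: ne_u; have := congr1 (fun z => u * z)%g eu.
  by rewrite mulKVg => /mulIg.
apply/eqP/ffunP => w; rewrite !ffunE.
rewrite (reindex_inj (h := fun u : 'S_d => (w * u^-1)%g)) /=; last first.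
  by move=> u v /mulgI/invg_inj.
apply: eq_bigr => u _; rewrite mulrC invMg invgK mulgKV; congr (_ * _).
by rewrite -(cx (w * u^-1)%g w) conjgE !mulgA mulVg mul1g.
Qed.

Lemma class_function_eq0 d (x : 'S_d -> rat) : (forall w g, x (w ^ g)%g = x w) ->
  (forall i : Iirr [set: 'S_d], \sum_(w : 'S_d) ratr (x w) * 'chi_i w = 0 :> algC) ->
  forall w, x w = 0.
Proof.
move=> cx orth w.
have class_x : is_class_fun <<[set: 'S_d]>>%g [ffun w : 'S_d => ratr (x w) : algC].
  by apply: intro_class_fun => [u v _ _|u]; [rewrite cx | rewrite mem_gen ?inE].
pose phi : 'CF([set: 'S_d]) := Cfun 0 class_x.
have phiE v : phi v = ratr (x v) by rewrite cfunE.
have phi0 : phi = 0.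
  rewrite [phi]cfun_sum_cfdot big1 // => i _.
  rewrite cfdotC cfdotE (eq_bigl predT) => [|v]; last by rewrite inE.
  rewrite (eq_bigr (fun v => ratr (x v) * 'chi_i v)) => [|v _].
    by rewrite orth mulr0 rmorph0 scale0r.
  by rewrite phiE fmorph_rat mulrC.
have := phiE w; rewrite phi0 cfunE => /esym/eqP.
by rewrite fmorph_eq0 => /eqP.
Qed.

(** Only degrees up to d enter, and in degree d the binomial coefficient is 1. *)
Lemma phi_top (x y : grpalgs) d la (e : psize la = d) :
    (forall d', (d' < d)%N -> x d' = y d') -> phi x la = phi y la ->
  \sum_(v : 'S_d) ratr (x d v) * 'chi_(ecast k (Iirr [set: 'S_k]) e (chi_index la)) v =
  \sum_(v : 'S_d) ratr (y d v) * 'chi_(ecast k (Iirr [set: 'S_k]) e (chi_index la)) v.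
Proof.
have at_chi (z : grpalgs) :
    \sum_(v : 'S_d) ratr (z d v) * 'chi_(ecast k (Iirr [set: 'S_k]) e (chi_index la)) v =
    \sum_(v : 'S_d) ratr (z d v) * chi_at la (cycle_type v).
  by apply: eq_bigr => v _; rewrite (chi_at_chi e).
rewrite !at_chi {at_chi}; case: d / e => eq_low.
rewrite !phiE => /(mulIf (invr_neq0 (irr1_neq0 _))).
rewrite !big_ord_recr /= binn !mul1r.
rewrite (eq_bigr (fun d : 'I_(psize la) => 'C(psize la, d)%:R *
     \sum_(w : 'S_d) ratr (y d w) * chi_at la (cycle_type w))) => [/addrI//|d _].
by rewrite eq_low.
Qed.

Lemma phi_inj (x y : grpalgs) : in_sum_centers x -> in_sum_centers y ->
  phi x =1 phi y -> forall d, x d = y d.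
Proof.
move=> [cx _] [cy _] eq_phi d; have [N] := ubnP d; elim: N d => // N IHN d /ltnSE-le_d.
have eq_low d' : (d' < d)%N -> x d' = y d'.
  by move=> lt_d'; apply: IHN; apply: leq_trans le_d.
apply/ffunP => w; apply/eqP; rewrite -subr_eq0; apply/eqP.
apply: (@class_function_eq0 d (fun w => x d w - y d w)) => [v g|i].
  by rewrite (in_centerP _).1 // [in y d _](in_centerP _).1.
have [la [e ->]] := irr_chi_index i.
under eq_bigr do rewrite rmorphB mulrBl.
by rewrite sumrB (phi_top e eq_low (eq_phi la)) subrr.
Qed.

Lemma cycle_typeJ d (w g : 'S_d) : cycle_type (w ^ g)%g = cycle_type w.
Proof.
have injg := @perm_inj _ g; have injS := imset_inj injg.
have porbitsJ : porbits (w ^ g)%g = (fun B : {set 'I_d} => g @: B) @: porbits w.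
  apply/setP => B; apply/imsetP/imsetP => [[x _ ->]|[_ /imsetP[x _ ->] ->]].
    by exists (porbit w (g^-1%g x)); rewrite ?imset_f // -porbit_conj permKV.
  by exists (g x); rewrite // porbit_conj.
apply: val_inj; rewrite /= /cycle_lengths; apply/perm_sortP.
- by move=> a b; rewrite /= leq_total.
- by move=> a b c /= ab bc; apply: leq_trans bc ab.
- by move=> a b ba; apply/eqP; rewrite eqn_leq andbC.
pose cycles := [seq g @: B | B : {set 'I_d} <- enum (porbits w)].
apply: (perm_trans (y := [seq #|B| | B : {set 'I_d} <- cycles])).
  apply: perm_map; apply: uniq_perm; rewrite ?enum_uniq ?map_inj_uniq ?enum_uniq //.
  move=> B; rewrite mem_enum porbitsJ; apply/imsetP/mapP => -[A AP ->].
    by exists A; rewrite ?mem_enum.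
  by exists A; rewrite mem_enum in AP.
by rewrite /cycles -map_comp (eq_map (g := fun B : {set 'I_d} => #|B|)) // => B /=; rewrite card_imset.
Qed.

(** * Identification of the completed cycles *)

Definition completed_formula (k : nat) : grpalgs :=
  fun d => [ffun w : 'S_d => k%:R * completion_formula k (cycle_type w)].

Lemma completion_formula_eq0 k (mu : intpart) : (k.+1 < psize mu)%N ->
  completion_formula k mu = 0.
Proof.
move=> lt_k; rewrite /completion_formula.
have [m ->] : exists m, k%:Z + 1 - (psize mu)%:Z - (size mu)%:Z = Negz m.
  exists (psize mu + size mu - k.+2)%N; rewrite NegzE; lia.
by rewrite mulr0.
Qed.

Lemma completed_formula_in_sum_centers k : in_sum_centers (completed_formula k).
Proof.
split=> [d|]; first by apply/in_centerP => w g; rewrite !ffunE cycle_typeJ.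
exists k.+2 => d le_d; apply/ffunP => w; rewrite !ffunE completion_formula_eq0 ?mulr0 //.
by rewrite psize_cycle_type.
Qed.

Lemma phi_completed_formula k : (1 <= k)%N ->
  phi (completed_formula k) =1 (fun la => ratr (p_ k la)).
Proof.
move=> k1 la; rewrite phiE; set n := psize la.
have dim0 : dim_chi la != 0 by apply: irr1_neq0.
apply: (canLR (mulfK dim0)); rewrite big_ord_recl bin0 mul1r.
rewrite (p_contents k (erefl : psize la = n)) rmorphD mulrDl addrC; congr (_ + _); last first.
  (* Degree 0 gives the zeta value: the one element of S_0 embeds as the identity, where the
     character is [dim_chi la]. *)
  rewrite (big_pred1 1%g) => [|w]; last by apply/esym/eqP/permP => -[].
  rewrite ffunE completion_formula_nil ?psize_cycle_type //; congr (_ * _).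
  have inj0 : injective (widen_ord (leq0n n)) by case.
  rewrite (chi_at_extend inj0).
  rewrite (_ : extend _ _ = 1%g) //; apply/permP => x.
  by rewrite perm1 extend_out //; apply/imsetP => -[[]].
rewrite [RHS]mulrC -(cycle_ser_eigenvalue k (erefl : psize la = n) (chi_index_constt la)).
transitivity (\sum_(d < n) \sum_(D : {set 'I_n} | #|D| == d.+1) \sum_(w | perm_on D w)
    ratr (fact_coef k (cycle_ser D w)) * chi la w : algC).
  apply: eq_bigr => d _; rewrite (@sum_sized_subsets la _ (fun a => ratr (fact_coef k a))).
  by congr (_ * _); apply: eq_bigr => w _; rewrite ffunE completion_formula_cycle_ser.
(* Summing over the sizes d + 1 covers each nonempty [D] once. *)
rewrite (exchange_big_dep (fun D : {set 'I_n} => D != set0)) /=; last first.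
  by move=> d D _ /eqP cD; rewrite -card_gt0 cD.
apply: eq_bigr => D; rewrite -card_gt0 => D0.
have lt_D : (#|D|.-1 < n)%N by rewrite prednK //; have := max_card D; rewrite card_ord.
rewrite (big_pred1 (Ordinal lt_D)) // => d /=.
by rewrite -val_eqE /= -[RHS]eqSS prednK // [RHS]eq_sym.
Qed.

Lemma phi_inv_p k d : (1 <= k)%N ->
  phi_inv (fun la => ratr (p_ k la)) d = completed_formula k d.
Proof.
move=> k1; set f := fun la => _.
have ex : exists x, in_sum_centers x /\ phi x =1 f.
  exists (completed_formula k); split; first exact: completed_formula_in_sum_centers.
  exact: phi_completed_formula.
have [cx fx] := epsilon_spec (inhabits (fun d => 0 : grpalg d)) _ ex.
apply: phi_inj => //; first exact: completed_formula_in_sum_centers.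
by move=> la; rewrite fx phi_completed_formula.
Qed.

Lemma completed_cycleE k d (w : 'S_d) : (1 <= k)%N ->
  completed_cycle k d w = completion_formula k (cycle_type w).
Proof.
by move=> k1; rewrite ffunE phi_inv_p // ffunE mulKf // pnatr_eq0 -lt0n.
Qed.

Lemma class_expansionP (x : grpalgs) (r : {fsfun intpart -> rat with 0}) :
  class_expansion x r <-> forall d (w : 'S_d), x d w = r (cycle_type w).
Proof.
have sumE d (w : 'S_d) : \sum_(mu <- finsupp r) r mu * class_sum mu d w = r (cycle_type w).
  under eq_bigr do rewrite ffunE.
  have [in_r|out_r] := boolP (cycle_type w \in finsupp r).
    rewrite (bigD1_seq (cycle_type w)) ?fset_uniq //= eqxx mulr1 big1 ?addr0 // => mu.
    by rewrite eq_sym => /negbTE ->; rewrite mulr0.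
  rewrite fsfun_dflt // big_seq big1 // => mu mu_in.
  by case: eqP => [e|]; [rewrite e mu_in in out_r | rewrite mulr0].
by split=> h d w; rewrite h sumE.
Qed.

Lemma ex_class_expansion k : (1 <= k)%N ->
  exists r, class_expansion (completed_cycle k) r.
Proof.
(* The support is finite because k + 1 = d + l + 2g with 2g nonnegative bounds d by k + 1. *)
move=> k1; pose s := flatten [seq [seq cycle_type w | w <- enum {: 'S_d}] | d <- iota 0 k.+2].
pose S := seq_fset tt s.
exists [fsfun mu in S => completion_formula k mu]; apply/class_expansionP => d w.
rewrite completed_cycleE // fsfunE; case: ifP => // /negbT; rewrite seq_fsetE => nin.
apply: completion_formula_eq0; rewrite psize_cycle_type ltnNge; apply: contra nin => le_d.
apply/flattenP; exists [seq cycle_type w | w <- enum {: 'S_d}].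
  by apply/mapP; exists d; rewrite ?mem_iota.
by apply/mapP; exists w; rewrite ?mem_enum.
Qed.

Lemma rhoE k mu : (1 <= k)%N -> rho k mu = completion_formula k mu.
Proof.
move=> k1; have := epsilon_spec (inhabits [fsfun]) _ (ex_class_expansion k1).
move/class_expansionP => h; have [w <-] := ex_cycle_type mu.
by rewrite /rho /completion_coeffs -h completed_cycleE.
Qed.

(* [two_g] is the integer 2g; the coefficient is 0 when it is odd or negative. *)
Theorem proposition3p2 (k : nat) (mu : intpart) (two_g : int)
    (hk : (1 <= k)%N)
    (hg : k%:Z + 1 = (psize mu)%:Z + (size mu)%:Z + two_g) :
  rho k mu =
    (k - 1)`!%:R * ((\prod_(m <- mu) m%:R) / (psize mu)`!%:R) *
    pser_coef two_g
      (pser_mul (pser_expz S_ser ((psize mu)%:Z - 1))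
         (\big[pser_mul/pser_one]_(m <- mu) pser_scale m%:R S_ser)).
Proof.
rewrite rhoE // /completion_formula; congr (_ * pser_coef _ _).
by rewrite hg; ring.
Qed.
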